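(* Let $R$ be a real closed field and $M\subset R^n$ a semialgebraic set. Suppose that the germ $M_q$ is semialgebraically connected for all $q\in\mathrm{Cl}(M)$. Then for each $f\in\mathcal{S}(M,R)$ there exist an open semialgebraic neighborhood $V$ of $M$ in $\mathrm{Cl}(M)$ and a semialgebraic set $Y\subset\mathrm{Cl}(M)\setminus M$ such that $\dim(Y_q)\leq\dim(M_q)-2$ for all $q\in Y$ and $f$ can be extended continuously to $V\setminus Y$.
   Context: $R^n$ carries the (Euclidean) order topology and $\mathrm{Cl}$ denotes closure in $R^n$. $\mathcal{S}(M,R)$ is the ring of semialgebraic functions on $M$, i.e. continuous functions $f:M\to R$ whose graph is semialgebraic. For a semialgebraic set $S$ and a point $q$, $S_q$ denotes the germ of $S$ at $q$, and $\dim(S_q)$ the local dimension, i.e. the minimum of $\dim(S\cap W)$ over open semialgebraic neighborhoods $W$ of $q$. The germ $S_q$ is semialgebraically connected if $q$ has arbitrarily small open semialgebraic neighborhoods $W$ with $S\cap W$ semialgebraically connected. *)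

(* Defs.v *)
From mathcomp Require Export all_boot all_order all_algebra.
From mathcomp Require Export boolp classical_sets topology normedtype.
From mathcomp Require mpoly.

Set Implicit Arguments.
Unset Strict Implicit.
Unset Printing Implicit Defensive.

Export numFieldNormedType.Exports.
Import Order.TTheory GRing.Theory Num.Theory.

Local Open Scope classical_set_scope.
Local Open Scope ring_scope.

(* R^n is 'rV[R]_n.  Its MathComp-Analysis topology is that of the sup norm,
   with balls of arbitrary positive radius in R; it is the product of the order
   topologies and coincides with the Euclidean topology. *)

(* The smallest Boolean algebra of subsets of R^n that contains all the sets
   {p > 0}, p a polynomial in n variables over R. *)
Inductive semialgebraic (R : rcfType) (n : nat) : set 'rV[R]_n -> Prop :=
| semialgebraic_pos (p : mpoly.mpoly n R) :
    semialgebraic [set x | 0 < mpoly.meval (fun i => x ord0 i) p]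
| semialgebraic_setC (A : set 'rV[R]_n) :
    semialgebraic A -> semialgebraic (~` A)
| semialgebraic_setU (A B : set 'rV[R]_n) :
    semialgebraic A -> semialgebraic B -> semialgebraic (A `|` B).

(* A map A -> R^m is represented by a total function on R^n whose values
   outside A are irrelevant. *)
Definition graph_on (R : rcfType) (n m : nat) (A : set 'rV[R]_n)
    (g : 'rV[R]_n -> 'rV[R]_m) : set 'rV[R]_(n + m) :=
  [set row_mx x (g x) | x in A].

Definition semialgebraic_map (R : rcfType) (n m : nat) (A : set 'rV[R]_n)
    (g : 'rV[R]_n -> 'rV[R]_m) : Prop :=
  semialgebraic (graph_on A g).

(* f belongs to the ring S(A, R): continuous on A with semialgebraic graph. *)
Definition semialgebraic_function (R : rcfType) (n : nat) (A : set 'rV[R]_n)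
    (f : 'rV[R]_n -> R) : Prop :=
  {within A, continuous f} /\
  semialgebraic_map A (fun x => const_mx (f x) : 'rV[R]_1).

Definition open_cube (R : rcfType) (k : nat) : set 'rV[R]_k :=
  [set x | forall i, 0 < x ord0 i < 1].

(* There is an injective semialgebraic (not necessarily continuous) map
   ]0, 1[^k -> S.  For k = 0 the cube is a point, so this means S nonempty. *)
Definition cube_embeds (R : rcfType) (n k : nat) (S : set 'rV[R]_n) : Prop :=
  exists phi : 'rV[R]_k -> 'rV[R]_n,
    [/\ semialgebraic_map (@open_cube R k) phi,
        {in @open_cube R k &, injective phi} &
        phi @` @open_cube R k `<=` S].

(* dim S = d.  The dimension of a semialgebraic set is the largest k such that
   there is an injective semialgebraic map ]0, 1[^k -> S, and -1 for S empty
   (Basu, Pollack, Roy, Algorithms in Real Algebraic Geometry, Section 5.3).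
   Stated as a relation, so that no default value is needed for sets of
   unbounded dimension. *)
Definition is_dim (R : rcfType) (n : nat) (S : set 'rV[R]_n) (d : int) : Prop :=
  ((S = set0 /\ d = -1) \/ (exists2 k : nat, d = k%:Z & cube_embeds k S)) /\
  (forall k : nat, cube_embeds k S -> k%:Z <= d).

Definition open_semialgebraic_nbhd (R : rcfType) (n : nat) (q : 'rV[R]_n)
    (W : set 'rV[R]_n) : Prop :=
  [/\ open W, semialgebraic W & W q].

(* dim (S_q) = d *)
Definition is_local_dim (R : rcfType) (n : nat) (S : set 'rV[R]_n)
    (q : 'rV[R]_n) (d : int) : Prop :=
  (exists2 W, open_semialgebraic_nbhd q W & is_dim (S `&` W) d) /\
  (forall W e, open_semialgebraic_nbhd q W -> is_dim (S `&` W) e -> d <= e).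

Definition closed_in (R : rcfType) (n : nat) (A F : set 'rV[R]_n) : Prop :=
  exists2 C, closed C & F = A `&` C.

Definition open_in (R : rcfType) (n : nat) (A V : set 'rV[R]_n) : Prop :=
  exists2 U, open U & V = A `&` U.

Definition semialgebraically_connected (R : rcfType) (n : nat)
    (A : set 'rV[R]_n) : Prop :=
  forall F1 F2 : set 'rV[R]_n,
    semialgebraic F1 -> semialgebraic F2 ->
    closed_in A F1 -> closed_in A F2 ->
    F1 `&` F2 = set0 -> F1 `|` F2 = A ->
    F1 = A \/ F2 = A.

Definition germ_connected (R : rcfType) (n : nat) (S : set 'rV[R]_n)
    (q : 'rV[R]_n) : Prop :=
  forall U, nbhs q U ->
    exists W, [/\ open_semialgebraic_nbhd q W, W `<=` U &
                  semialgebraically_connected (S `&` W)].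

(* Main.v *)
(* At a point q of the closure of M near which f is bounded, f extends
   continuously unless it oscillates, i.e., unless there are a < b such that f
   takes values < a and values > b on M arbitrarily close to q.  Then, the germ
   of M at q being connected, the whole segment {q} x ]a, b[ lies in the closure
   of the graph of f.  So if Y is the set of such points q outside M, then
   dim Y + 1 <= dim (closure (graph f) \ graph f) < dim (graph f) = dim M,
   and this holds locally.

   The dimension theory rests on a game-like dimension [qdim] of a definable set,
   counting the quantifiers "there exist infinitely many" in a prefix that makes
   the set hold.  Two such quantifiers commute because a polynomial has finitely
   many roots, whence the invariance under definable bijections, the equivalence
   with embeddings of cubes (by definable choice), and van den Dries' proof that
   the frontier of a set has smaller dimension. *)

Require Import Defs.
From mathcomp Require Import ring lra zify.
From mathcomp Require ordered_qelim qe_rcf.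
From mathcomp Require polyrcf mpoly.
Import (canonicals) mpoly.

Set Implicit Arguments.
Unset Strict Implicit.
Unset Printing Implicit Defensive.

Import Order.TTheory GRing.Theory Num.Theory.
Import numFieldNormedType.Exports.

Local Open Scope classical_set_scope.
Local Open Scope ring_scope.

(** * Definable sets and quantifier elimination *)

(** R is an arbitrary real closed field, so neither completeness nor local compactness is available.
    Every supremum, choice function or interval has to come from definability in one variable, that
    is, from polynomials having finitely many roots; quantifier elimination keeps all first-order
    conditions definable. Embedded cubes do not slice well along coordinates. The recursion defining
    [qdim] does: fibers over a coordinate are its induction step, and this is what the frontier
    argument needs. V consists of the points of Cl(M) near which f is bounded. Removing the other
    points costs nothing, since they form a closed subset of Cl(M) that misses M, and it makes every
    limit an element of R. The dimension bound is proved for the parts of Y and M in any open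
    semialgebraic W; the local bound follows with a W that realizes the local dimension of M. *)

Section Definable.
Variable R : rcfType.

Definition scons (x : R) (rho : nat -> R) : nat -> R :=
  fun i => if i is j.+1 then rho j else x.

(** Predicates on valuations replace formulas: equivalent predicates are equal, and countably many
    variables spare the tracking of arities. Each polynomial still uses finitely many variables. *)
Inductive polyfun : ((nat -> R) -> R) -> Prop :=
| polyfun_var i : polyfun (fun rho => rho i)
| polyfun_cst c : polyfun (fun=> c)
| polyfunD p q : polyfun p -> polyfun q -> polyfun (fun rho => p rho + q rho)
| polyfunM p q : polyfun p -> polyfun q -> polyfun (fun rho => p rho * q rho).

Inductive definable : ((nat -> R) -> Prop) -> Prop :=
| definable_pos p : polyfun p -> definable (fun rho => 0 < p rho)
| definable_not P : definable P -> definable (fun rho => ~ P rho)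
| definable_or P Q :
    definable P -> definable Q -> definable (fun rho => P rho \/ Q rho).

Lemma polyfunN p : polyfun p -> polyfun (fun rho => - p rho).
Proof.
move=> hp; have := polyfunM (polyfun_cst (-1)) hp.
by congr polyfun; apply/funext => rho; rewrite mulN1r.
Qed.

Lemma polyfunB p q :
  polyfun p -> polyfun q -> polyfun (fun rho => p rho - q rho).
Proof. by move=> hp hq; apply: polyfunD => //; apply: polyfunN. Qed.

Lemma polyfunX p k : polyfun p -> polyfun (fun rho => p rho ^+ k).
Proof.
move=> hp; elim: k => [|k IH]; first exact: polyfun_cst.
have := polyfunM hp IH; congr polyfun.
by apply/funext => rho; rewrite exprS.
Qed.

Lemma polyfun_sum (I : Type) (s : seq I) (F : I -> (nat -> R) -> R) :
  (forall i, polyfun (F i)) -> polyfun (fun rho => \sum_(i <- s) F i rho).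
Proof.
move=> hF; elim: s => [|i s IH].
  have := polyfun_cst 0; congr polyfun.
  by apply/funext => rho; rewrite big_nil.
have := polyfunD (hF i) IH; congr polyfun.
by apply/funext => rho; rewrite big_cons.
Qed.

Lemma polyfun_prod (I : Type) (s : seq I) (F : I -> (nat -> R) -> R) :
  (forall i, polyfun (F i)) -> polyfun (fun rho => \prod_(i <- s) F i rho).
Proof.
move=> hF; elim: s => [|i s IH].
  have := polyfun_cst 1; congr polyfun.
  by apply/funext => rho; rewrite big_nil.
have := polyfunM (hF i) IH; congr polyfun.
by apply/funext => rho; rewrite big_cons.
Qed.

Lemma definable_iff P Q :
  definable P -> (forall rho, P rho <-> Q rho) -> definable Q.
Proof. by move=> + PQ; congr definable; apply/funext => rho; apply/propext. Qed.

Lemma definable_and P Q :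
  definable P -> definable Q -> definable (fun rho => P rho /\ Q rho).
Proof.
move=> hP hQ.
apply: (definable_iff (definable_not (definable_or (definable_not hP)
  (definable_not hQ)))) => rho.
by rewrite not_orE !notE.
Qed.

Lemma definable_imp P Q :
  definable P -> definable Q -> definable (fun rho => P rho -> Q rho).
Proof.
move=> hP hQ; apply: (definable_iff (definable_or (definable_not hP) hQ)) => rho.
by rewrite implyE.
Qed.

Lemma definable_const (P : Prop) : definable (fun=> P).
Proof.
have [hP|hP] := EM P.
  by apply: (definable_iff (definable_pos (polyfun_cst 1))) => rho; rewrite ltr01.
by apply: (definable_iff (definable_pos (polyfun_cst 0))) => rho; rewrite ltxx.
Qed.

Lemma definable_lt p q :
  polyfun p -> polyfun q -> definable (fun rho => p rho < q rho).
Proof.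
move=> hp hq; apply: (definable_iff (definable_pos (polyfunB hq hp))) => rho.
by rewrite subr_gt0.
Qed.

Lemma definable_le p q :
  polyfun p -> polyfun q -> definable (fun rho => p rho <= q rho).
Proof.
move=> hp hq; apply: (definable_iff (definable_not (definable_lt hq hp))) => rho.
by rewrite leNgt; split=> /negP.
Qed.

Lemma definable_eq p q :
  polyfun p -> polyfun q -> definable (fun rho => p rho = q rho).
Proof.
move=> hp hq; apply: (definable_iff (definable_and (definable_le hp hq) (definable_le hq hp))) => rho.
by split=> [[h1 h2]|->//]; apply/le_anti/andP.
Qed.

Lemma definable_all (I : eqType) (s : seq I) (P : I -> (nat -> R) -> Prop) :
  (forall i, definable (P i)) ->
  definable (fun rho => forall i, i \in s -> P i rho).
Proof.
move=> hP; elim: s => [|i s IH].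
  by apply: (definable_iff (definable_const True)) => rho; split.
apply: (definable_iff (definable_and (hP i) IH)) => rho; split.
  by case=> h1 h2 j; rewrite inE => /predU1P[->|/h2].
move=> h; split; first by apply: h; rewrite mem_head.
by move=> j js; apply: h; rewrite inE js orbT.
Qed.

Lemma definable_has (I : eqType) (s : seq I) (P : I -> (nat -> R) -> Prop) :
  (forall i, definable (P i)) ->
  definable (fun rho => exists2 i, i \in s & P i rho).
Proof.
move=> hP; apply: (definable_iff (definable_not (definable_all s
  (fun i => definable_not (hP i))))) => rho; split.
  by move=> h; apply: contrapT => h'; apply: h => i is_ Pi; apply: h'; exists i.
by move=> [i is_ Pi] h; exact: h Pi.
Qed.

Lemma definable_all_fin (I : finType) (P : I -> (nat -> R) -> Prop) :
  (forall i, definable (P i)) -> definable (fun rho => forall i, P i rho).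
Proof.
move=> hP; apply: (definable_iff (definable_all (enum I) hP)) => rho.
by split=> h i; [apply: h; rewrite mem_enum|move=> _; exact: h].
Qed.

Lemma definable_all_ltn n (P : nat -> (nat -> R) -> Prop) :
  (forall i, definable (P i)) ->
  definable (fun rho => forall i, (i < n)%N -> P i rho).
Proof.
move=> hP; apply: (definable_iff (definable_all (iota 0 n) hP)) => rho.
by split=> h i; have := h i; rewrite mem_iota add0n.
Qed.

Lemma polyfun_subst p (sigma : nat -> (nat -> R) -> R) :
  (forall i, polyfun (sigma i)) -> polyfun p ->
  polyfun (fun rho => p (fun i => sigma i rho)).
Proof.
move=> hs; elim=> [i|c|q r _ hq _ hr|q r _ hq _ hr].
- exact: hs.
- exact: polyfun_cst.
- exact: polyfunD.
- exact: polyfunM.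
Qed.

Lemma definable_subst P (sigma : nat -> (nat -> R) -> R) :
  (forall i, polyfun (sigma i)) -> definable P ->
  definable (fun rho => P (fun i => sigma i rho)).
Proof.
move=> hs; elim=> [p hp|Q _ hQ|P1 P2 _ h1 _ h2].
- exact/definable_pos/polyfun_subst.
- exact: definable_not.
- exact: definable_or.
Qed.

Lemma eval_polyfun N (sigma : nat -> (nat -> R) -> R) (t : GRing.term R) :
  (forall i, polyfun (sigma i)) -> GRing.rterm t ->
  polyfun (fun rho => GRing.eval (mkseq (fun i => sigma i rho) N) t).
Proof.
move=> hs; elim: t => //=.
- move=> i _; case: (ltnP i N) => hi.
    have := hs i; congr polyfun; apply/funext => rho.
    by rewrite nth_mkseq.
  have := polyfun_cst 0; congr polyfun; apply/funext => rho.
  by rewrite nth_default // size_mkseq.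
- by move=> c _; exact: polyfun_cst.
- by move=> n _; exact: polyfun_cst.
- by move=> t1 h1 t2 h2 /andP[/h1 ? /h2 ?]; exact: polyfunD.
- by move=> t h /h; exact: polyfunN.
- move=> t h n /h /(polyfunM (polyfun_cst n%:R)); congr polyfun.
  by apply/funext => rho; rewrite mulr_natl.
- by move=> t1 h1 t2 h2 /andP[/h1 ? /h2 ?]; exact: polyfunM.
- by move=> t h n /h; exact: polyfunX.
Qed.

Lemma qf_eval_definable N (sigma : nat -> (nat -> R) -> R) (f : ordered_qelim.ord.formula R) :
  (forall i, polyfun (sigma i)) -> ordered_qelim.ord.qf_form f -> ordered_qelim.ord.rformula f ->
  definable (fun rho => ordered_qelim.ord.qf_eval (mkseq (fun i => sigma i rho) N) f).
Proof.
move=> hs; elim: f => //=.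
- by move=> b _ _; exact: definable_const.
- move=> t1 t2 _ /andP[h1 h2]; apply: (definable_iff (definable_eq
    (eval_polyfun N hs h1) (eval_polyfun N hs h2))) => rho.
  by split=> /eqP.
- by move=> t1 t2 _ /andP[h1 h2]; apply: definable_lt; exact: eval_polyfun.
- by move=> t1 t2 _ /andP[h1 h2]; apply: definable_le; exact: eval_polyfun.
- move=> f1 h1 f2 h2 /andP[q1 q2] /andP[r1 r2].
  apply: (definable_iff (definable_and (h1 q1 r1) (h2 q2 r2))) => rho.
  by split=> /andP.
- move=> f1 h1 f2 h2 /andP[q1 q2] /andP[r1 r2].
  apply: (definable_iff (definable_or (h1 q1 r1) (h2 q2 r2))) => rho.
  by split=> /orP.
- move=> f1 h1 f2 h2 /andP[q1 q2] /andP[r1 r2].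
  apply: (definable_iff (definable_imp (h1 q1 r1) (h2 q2 r2))) => rho.
  by split=> /implyP.
- move=> f h q r; apply: (definable_iff (definable_not (h q r))) => rho.
  by split=> /negP.
Qed.

Lemma polyfun_eval p : polyfun p -> exists (t : GRing.term R) N,
  GRing.rterm t /\ forall rho e,
    (forall i, (i < N)%N -> nth 0 e i = rho i) -> GRing.eval e t = p rho.
Proof.
elim=> [i|c|q r _ [t [N [h e]]] _ [u [M [h' e']]]
  |q r _ [t [N [h e]]] _ [u [M [h' e']]]].
- by exists (GRing.Var _ i), i.+1; split=> // rho e /(_ i); apply.
- by exists (GRing.Const c), 0%N.
- exists (GRing.Add t u), (maxn N M); split=> [/=|rho s hs /=]; first exact/andP.
  rewrite (e rho) ?(e' rho)// => i hi; apply: hs; rewrite leq_max hi ?orbT//.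
- exists (GRing.Mul t u), (maxn N M); split=> [/=|rho s hs /=]; first exact/andP.
  rewrite (e rho) ?(e' rho)// => i hi; apply: hs; rewrite leq_max hi ?orbT//.
Qed.

Lemma definable_formula P : definable P -> exists (f : ordered_qelim.ord.formula R) N,
  ordered_qelim.ord.rformula f /\ forall rho e,
    (forall i, (i < N)%N -> nth 0 e i = rho i) -> ordered_qelim.ord.holds e f <-> P rho.
Proof.
elim=> [p /polyfun_eval[t [N [h e]]]|Q _ [f [N [h e]]]
  |Q1 Q2 _ [f [N [h e]]] _ [g [M [h' e']]]].
- exists (ordered_qelim.ord.Lt (GRing.Const 0) t), N; split=> // rho s hs /=.
  by rewrite (e rho).
- exists (ordered_qelim.ord.Not f), N; split=> // rho s hs /=.
  by have := e rho s hs; tauto.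
- exists (ordered_qelim.ord.Or f g), (maxn N M); split=> [/=|rho s hs /=]; first exact/andP.
  have := e rho s; have := e' rho s => /[swap] h1 h2.
  suff: (forall i, (i < N)%N -> s`_i = rho i) /\
        (forall i, (i < M)%N -> s`_i = rho i) by tauto.
  by split=> i hi; apply: hs; rewrite leq_max hi ?orbT.
Qed.

(** Quantifier elimination: the predicate becomes a formula, its variable 0 is eliminated, and the
    quantifier-free result is read back. By convention a bound variable is number 0 and the
    parameters are shifted by one. *)
Lemma definable_ex (P : R -> (nat -> R) -> Prop) :
  definable (fun rho => P (rho 0) (fun i => rho i.+1)) ->
  definable (fun rho => exists x, P x rho).
Proof.
move=> /definable_formula[f [N [rf hf]]].
pose g : ordered_qelim.ord.formula R := ordered_qelim.ord.Exists 0 f.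
have rg : ordered_qelim.ord.rformula g by [].
have /andP[qg rg'] := ordered_qelim.ord.quantifier_elim_wf (@qe_rcf.wf_QE_wproj R) rg.
(* Slot 0 belongs to the bound variable; the 0 put there is overwritten by [set_nth] when the
   quantifier is evaluated. *)
pose sigma i := if i is j.+1 then fun rho : nat -> R => rho j else fun=> 0.
have hs i : polyfun (sigma i).
  by case: i => [|i]; [exact: polyfun_cst|exact: polyfun_var].
apply: (definable_iff (qf_eval_definable N.+1 hs qg rg')) => rho.
have -> : ordered_qelim.ord.qf_eval (mkseq (fun i => sigma i rho) N.+1)
    (ordered_qelim.ord.quantifier_elim
      (fun i bc => qe_rcf.qfr_to_formula (qe_rcf.wproj i bc)) g) <->
    ordered_qelim.ord.holds (mkseq (fun i => sigma i rho) N.+1) g.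
  by split=> /(ordered_qelim.ord.quantifier_elim_rformP (@qe_rcf.wf_QE_wproj R)
    (@qe_rcf.valid_QE_wproj R) _ rg).
have key x : ordered_qelim.ord.holds (set_nth 0 (mkseq (fun i => sigma i rho) N.+1) 0 x) f
    <-> P x rho.
  apply: (hf (scons x rho)) => -[//|i] hi.
  by rewrite nth_set_nth /= (nth_map 0%N) ?size_iota ?nth_iota ?(ltnW hi).
by rewrite /=; split=> -[x /key hx]; exists x.
Qed.

Lemma definable_forall (P : R -> (nat -> R) -> Prop) :
  definable (fun rho => P (rho 0) (fun i => rho i.+1)) ->
  definable (fun rho => forall x, P x rho).
Proof.
move=> hP; have := definable_not (@definable_ex (fun x rho => ~ P x rho)
  (definable_not hP)); move/definable_iff; apply=> rho.
by split=> [h x|h [x]]; [apply: contrapT => hx; apply: h; exists x|apply].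
Qed.

End Definable.

(** * Semialgebraic sets as definable predicates; quantifiers over tuples and points *)

Section Blocks.
Variable R : rcfType.
Implicit Types (rho : nat -> R).

Lemma definable_rename (P : (nat -> R) -> Prop) (g : nat -> nat) :
  definable P -> definable (fun rho => P (fun i => rho (g i))).
Proof.
by move=> hP; apply: (definable_subst (sigma := fun i rho => rho (g i))) => // i;
  exact: polyfun_var.
Qed.

Lemma polyfun_nth n (sigma : nat -> (nat -> R) -> R) i :
  (forall i, polyfun (sigma i)) ->
  polyfun (fun rho => nth 0 (mkseq (fun i => sigma i rho) n) i).
Proof. by move=> h; apply: (eval_polyfun n (t := GRing.Var _ i) h). Qed.

Lemma polyfun_row n (sigma : nat -> (nat -> R) -> R) (j : 'I_n) :
  (forall i, polyfun (sigma i)) ->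
  polyfun (fun rho => (\row_(i < n) sigma i rho) ord0 j).
Proof.
by move=> h; have := h j; congr polyfun; apply/funext => rho; rewrite mxE.
Qed.

Lemma meval_polyfun n (p : mpoly.mpoly n R) :
  polyfun (fun rho =>
    mpoly.meval (fun i => (\row_(i < n) rho i) ord0 i) p).
Proof.
have := polyfun_sum (mpoly.msupp p) (F := fun m rho =>
  mpoly.mcoeff m p * \prod_(i <- index_enum 'I_n) (\row_(i < n) rho i) ord0 i ^+ mpoly.fun_of_multinom m i).
have h : forall m, polyfun (fun rho => mpoly.mcoeff m p *
    \prod_(i <- index_enum 'I_n) (\row_(i < n) rho i) ord0 i ^+ mpoly.fun_of_multinom m i).
  move=> m; apply: polyfunM; first exact: polyfun_cst.
  apply: polyfun_prod => i; apply: polyfunX.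
  by apply: (polyfun_row (sigma := fun i rho => rho i)) => ?; exact: polyfun_var.
by move/(_ h); congr polyfun; apply/funext => rho; rewrite mpoly.mevalE.
Qed.

Lemma semialgebraic_definable n (S : set 'rV[R]_n) :
  semialgebraic S -> definable (fun rho => S (\row_(i < n) rho i)).
Proof.
elim=> [p|A _ hA|A B _ hA _ hB].
- exact/definable_pos/meval_polyfun.
- exact: definable_not.
- exact: definable_or.
Qed.

(** Setting the variables of index at least n to 0 leaves a genuine polynomial in n variables. *)
Lemma polyfun_meval n (p : (nat -> R) -> R) : polyfun p ->
  exists q : mpoly.mpoly n R, forall x : 'rV[R]_n,
    mpoly.meval (fun i => x ord0 i) q =
    p (fun i => if insub i is Some j then x ord0 j else 0).
Proof.
elim=> [i|c|q r _ [q' hq] _ [r' hr]|q r _ [q' hq] _ [r' hr]].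
- case: (insub i) => [j|].
    by exists (mpoly.mpolyX R (mpoly.mnm1 j)) => x; rewrite mpoly.mevalXU.
  by exists (mpoly.mpolyC n 0) => x; rewrite mpoly.mevalC.
- by exists (mpoly.mpolyC n c) => x; rewrite mpoly.mevalC.
- by exists (q' + r') => x; rewrite mpoly.mevalD hq hr.
- by exists (q' * r') => x; rewrite mpoly.mevalM hq hr.
Qed.

Lemma definable_semialgebraic n (S : set 'rV[R]_n) :
  definable (fun rho => S (\row_(i < n) rho i)) -> semialgebraic S.
Proof.
pose ext (x : 'rV[R]_n) i := if insub i is Some j then x ord0 j else 0.
have key P : definable P -> semialgebraic [set x | P (ext x)].
  elim=> [p hp|{}P _ hP|{}P Q _ hP _ hQ].
  - have [q hq] := polyfun_meval n hp.
    have := semialgebraic_pos q; congr semialgebraic.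
    by apply/funext => x /=; rewrite hq.
  - exact: (semialgebraic_setC hP).
  - exact: (semialgebraic_setU hP hQ).
move=> /key; congr semialgebraic; apply/funext => x /=; congr (S _).
by apply/rowP => i; rewrite mxE /ext valK.
Qed.

Lemma definable_mem n (S : set 'rV[R]_n) (sigma : nat -> (nat -> R) -> R) :
  semialgebraic S -> (forall i, polyfun (sigma i)) ->
  definable (fun rho => S (\row_(i < n) sigma i rho)).
Proof.
by move=> /semialgebraic_definable hS hs; exact: (definable_subst hs hS).
Qed.

Lemma definable_ex_seq n (P : seq R -> (nat -> R) -> Prop) :
  definable (fun rho => P (mkseq rho n) (fun i => rho (n + i)%N)) ->
  definable (fun rho => exists2 s, size s = n & P s rho).
Proof.
elim: n P => [|n IH] P hP.
  apply: (definable_iff hP) => rho; split; first by exists [::].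
  by case=> s /size0nil ->.
suff: definable (fun rho => exists2 s, size s = n & exists x, P (rcons s x) rho).
  move/definable_iff; apply=> rho; split.
    by case=> s hs [x hx]; exists (rcons s x); rewrite ?size_rcons ?hs.
  case=> s; elim/last_ind: s => // s x _; rewrite size_rcons => -[hs] hP'.
  by exists s => //; exists x.
apply: (IH (fun s rho => exists x, P (rcons s x) rho)).
apply: (definable_ex (P := fun x rho =>
  P (rcons (mkseq rho n) x) (fun i => rho (n + i)%N))).
(* The innermost quantifier binds the last entry as variable 0; [g] puts it back in place n, after
   the other entries. *)
pose g i := if (i < n)%N then i.+1 else if i == n then 0%N else i.
apply: (definable_iff (definable_rename g hP)) => rho.
suff -> : mkseq (fun i => rho (g i)) n.+1 =
    rcons (mkseq (fun i => rho i.+1) n) (rho 0%N).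
  suff -> : (fun i => rho (g (n.+1 + i)%N)) = (fun i => rho (n + i).+1) by [].
  apply/funext => i; rewrite /g ltnNge (leq_trans (leqnSn n)) ?leq_addr//=.
  by rewrite gtn_eqF ?leq_addr.
rewrite mkseqS; congr (rcons _ _); last by rewrite /g ltnn eqxx.
by apply/eq_in_map => i; rewrite mem_iota => /andP[_]; rewrite /g add0n => ->.
Qed.

Lemma rowP_mkseq n (x : 'rV[R]_n) :
  exists2 s, size s = n & x = \row_(i < n) s`_i.
Proof.
exists [seq x ord0 i | i <- enum 'I_n]; first by rewrite size_map size_enum_ord.
by apply/rowP => i; rewrite mxE (nth_map i) ?size_enum_ord// nth_ord_enum.
Qed.

Lemma row_mkseq n (v : nat -> R) :
  \row_(i < n) (mkseq v n)`_i = \row_(i < n) v i.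
Proof. by apply/rowP => i; rewrite !mxE nth_mkseq. Qed.

Lemma definable_ex_row n (P : 'rV[R]_n -> (nat -> R) -> Prop) :
  definable (fun rho => P (\row_(i < n) rho i) (fun i => rho (n + i)%N)) ->
  definable (fun rho => exists x, P x rho).
Proof.
move=> hP.
have := @definable_ex_seq n (fun s rho => P (\row_(i < n) s`_i) rho).
move=> /(_ _)/definable_iff; apply.
  by apply: (definable_iff hP) => rho; rewrite row_mkseq.
move=> rho; split=> [[s _ hs]|[x]]; first by exists (\row_i s`_i).
by have [s hs ->] := rowP_mkseq x; exists s.
Qed.

Lemma definable_abs_lt (p q : (nat -> R) -> R) : polyfun p -> polyfun q ->
  definable (fun rho => `|p rho| < q rho).
Proof.
move=> hp hq; apply: (definable_iff (definable_and
  (definable_lt (polyfunN hq) hp) (definable_lt hp hq))) => rho.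
by rewrite ltr_norml; split=> /andP.
Qed.

End Blocks.

(** * Definable subsets of the line *)

Section Line.
Variable R : rcfType.
Implicit Types (rho : nat -> R) (S T : R -> Prop).

Lemma polyfun_curve (p : (nat -> R) -> R) (sigma : nat -> {poly R}) :
  polyfun p -> exists q : {poly R}, forall t, p (fun i => (sigma i).[t]) = q.[t].
Proof.
elim=> [i|c|q r _ [q' hq] _ [r' hr]|q r _ [q' hq] _ [r' hr]].
- by exists (sigma i).
- by exists c%:P => t; rewrite hornerC.
- by exists (q' + r') => t; rewrite hornerD hq hr.
- by exists (q' * r') => t; rewrite hornerM hq hr.
Qed.

Lemma polyfun_line (p : (nat -> R) -> R) rho : polyfun p ->
  exists q : {poly R}, forall t, p (scons t rho) = q.[t].
Proof.
move=> hp; pose sigma i : {poly R} := if i is j.+1 then (rho j)%:P else 'X.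
have [q hq] := polyfun_curve sigma hp; exists q => t; rewrite -hq.
by congr p; apply/funext => -[|i]; rewrite /= (hornerX, hornerC).
Qed.

Lemma polyfun_finite_roots (p : (nat -> R) -> R) rho u : polyfun p ->
  p (scons u rho) <> 0 ->
  exists s : seq R, forall t, p (scons t rho) = 0 -> t \in s.
Proof.
move=> /(polyfun_line rho)[q hq] pu; exists (polyrcf.rootsR q) => t pt.
have q0 : q != 0.
  by apply/eqP => q0; apply: pu; rewrite hq q0 horner0.
have := polyrcf.roots_on_rootsR q0 t.
by rewrite /= rootE -hq pt eqxx => <-.
Qed.

(** Intermediate value theorem. The hypothesis lets p have a zero in [a, b] only if p vanishes on
    the whole line, where the sign is constant as well. *)
Lemma polyfun_sgr_const (p : (nat -> R) -> R) rho a b : polyfun p -> a <= b ->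
  (forall z u, a <= z <= b -> p (scons z rho) = 0 -> p (scons u rho) = 0) ->
  Num.sg (p (scons a rho)) = Num.sg (p (scons b rho)).
Proof.
move=> /(polyfun_line rho)[q hq] ab noroot; rewrite !hq.
have [h|] := boolP (q.[a] * q.[b] <= 0).
  have [z zab /rootP qz] := polyrcf.poly_ivt ab h.
  have q0 u : q.[u] = 0 by rewrite -hq (noroot z) ?hq.
  by rewrite !q0.
rewrite -ltNge => h.
have [qa|qa|qa] := ltgtP q.[a] 0.
- have qb : q.[b] < 0 by rewrite -(nmulr_rgt0 _ qa).
  by rewrite !ltr0_sg.
- have qb : 0 < q.[b] by rewrite -(pmulr_rgt0 _ qa).
  by rewrite !gtr0_sg.
- by move: h; rewrite qa mul0r ltxx.
Qed.

Lemma definable_signs (P : (nat -> R) -> Prop) : definable P ->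
  exists N (p : nat -> (nat -> R) -> R), (forall i, polyfun (p i)) /\
  forall rho rho',
    (forall i, (i < N)%N -> Num.sg (p i rho) = Num.sg (p i rho')) ->
    P rho <-> P rho'.
Proof.
elim=> [p hp|{}P _ [N [p [hp h]]]|{}P Q _ [N [p [hp h]]] _ [M [q [hq h']]]].
- exists 1%N, (fun=> p); split=> // rho rho' /(_ 0%N isT) e.
  by rewrite -sgr_gt0 e sgr_gt0.
- by exists N, p; split=> // rho rho' /h; tauto.
- exists (N + M)%N, (fun i => if (i < N)%N then p i else q (i - N)%N); split.
    by move=> i; case: ifP.
  move=> rho rho' e; suff: (P rho <-> P rho') /\ (Q rho <-> Q rho') by tauto.
  split.
    by apply: h => i hi; have := e i; rewrite hi ltn_addr//; apply.
  by apply: h' => i hi; have := e (N + i)%N;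
    rewrite ltn_add2l hi ltnNge leq_addr addKn; apply.
Qed.

(* The zeros of the nonzero polynomials among those whose signs determine P. *)
Lemma definable_breakpoints (P : (nat -> R) -> Prop) : definable P ->
  exists Z : R -> (nat -> R) -> Prop,
  [/\ definable (fun rho => Z (rho 0%N) (fun i => rho i.+1)),
      forall rho, exists s : seq R, forall t, Z t rho -> t \in s &
      forall rho a b, a <= b -> (forall z, a <= z <= b -> ~ Z z rho) ->
        P (scons a rho) <-> P (scons b rho)].
Proof.
move=> /definable_signs[N [p [hp hP]]].
exists (fun z rho => exists2 i, i \in iota 0 N &
  p i (scons z rho) = 0 /\ exists u, p i (scons u rho) <> 0); split.
- apply: definable_has => i; apply: definable_and.
    apply: definable_eq; last exact: polyfun_cst.
    apply: (@polyfun_subst _ (p i)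
      (fun j rho => scons (rho 0%N) (fun i => rho i.+1) j)) => // -[|j];
      exact: polyfun_var.
  apply: (definable_ex (P := fun u rho => p i (scons u (fun j => rho j.+1)) <> 0)).
  apply/definable_not/definable_eq; last exact: polyfun_cst.
  apply: (@polyfun_subst _ (p i)
    (fun j rho => scons (rho 0%N) (fun i => rho i.+2) j)) => // -[|j];
    exact: polyfun_var.
- move=> rho; have {hP} : forall n, (exists s : seq R, forall i, (i < n)%N ->
      forall t u, p i (scons t rho) = 0 -> p i (scons u rho) <> 0 -> t \in s).
    elim=> [|n [s hs]]; first by exists [::].
    have [[u pu]|h] := EM (exists u, p n (scons u rho) <> 0).
      have [s' hs'] := polyfun_finite_roots (hp n) pu.
      exists (s ++ s') => i; rewrite ltnS leq_eqVlt => /orP[/eqP ->|hi] t v h1 h2.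
        by rewrite mem_cat hs' ?orbT.
      by rewrite mem_cat (hs i hi t v).
    exists s => i; rewrite ltnS leq_eqVlt => /orP[/eqP ->|hi] t v h1 h2.
      by case: h; exists v.
    exact: hs h2.
  move=> /(_ N)[s hs]; exists s => t [i]; rewrite mem_iota => /andP[_ hi].
  by move=> [h1 [u h2]]; exact: hs h2.
- move=> rho a b ab nz; apply: hP => i hi.
  apply: polyfun_sgr_const => // z u zab pz; apply: contrapT => pu.
  by apply: (nz z zab); exists i; [rewrite mem_iota|split=> //; exists u].
Qed.

Lemma seq_gap (s : seq R) x : x \notin s ->
  exists2 d, 0 < d & forall z, x - d <= z <= x + d -> z \notin s.
Proof.
elim: s => [_|y s IH]; first by exists 1.
rewrite inE negb_or => /andP[xy /IH[d d0 hd]].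
exists (Num.min d (`|x - y| / 2)).
  by rewrite lt_min d0 divr_gt0 // normr_gt0 subr_eq0.
have : Num.min d (`|x - y| / 2) <= d by rewrite ge_min lexx.
have : Num.min d (`|x - y| / 2) <= `|x - y| / 2 by rewrite ge_min lexx orbT.
set m := Num.min _ _ => mxy md z /andP[z1 z2].
rewrite inE negb_or; apply/andP; split; last first.
  by apply: hd; apply/andP; split; lra.
apply/eqP => zy; subst z.
have xy0 : 0 < `|x - y| by rewrite normr_gt0 subr_eq0.
have : `|x - y| <= m by rewrite ler_norml; apply/andP; split; lra.
lra.
Qed.

(** * Infinite definable subsets of the line *)

Definition infinite S := forall s : seq R, exists2 x, S x & x \notin s.

Lemma infinite_sub S T : (forall x, S x -> T x) -> infinite S -> infinite T.
Proof. by move=> ST hS s; have [x /ST ? ?] := hS s; exists x. Qed.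

Lemma infinite_or S T : infinite (fun x => S x \/ T x) -> infinite S \/ infinite T.
Proof.
move=> h; apply: contrapT => /not_orP[/existsNP[s hs] /existsNP[t ht]].
have [x + ] := h (s ++ t); rewrite mem_cat negb_or => hx /andP[xs xt].
by case: hx => hx; [apply: hs|apply: ht]; exists x.
Qed.

Lemma infinite_has N (S : nat -> R -> Prop) :
  infinite (fun x => exists2 i, (i < N)%N & S i x) ->
  exists2 i, (i < N)%N & infinite (S i).
Proof.
elim: N => [h|N IH h]; first by have [x []] := h [::].
have /infinite_or[/IH[i iN hi]|hN] :
    infinite (fun x => (exists2 i, (i < N)%N & S i x) \/ S N x).
  apply: infinite_sub h => x [i]; rewrite ltnS leq_eqVlt => /orP[/eqP->|]; auto.
  by left; exists i.
- by exists i => //; exact: ltnW.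
- by exists N.
Qed.

Lemma infinite_ex S : infinite S -> exists x, S x.
Proof. by move=> /(_ [::])[x]; exists x. Qed.

Lemma infinite_itv a b : a < b -> infinite (fun x => a < x < b).
Proof.
move=> ab s; elim: s a b ab => [|y s IH] a b ab.
  by exists ((a + b) / 2) => //; apply/andP; split; lra.
have [h|h] := leP ((a + b) / 2) y.
  have [|x /andP[x1 x2] xs] := IH a ((a + b) / 2); first by lra.
  exists x; first by apply/andP; split; lra.
  by rewrite inE negb_or xs andbT; apply/eqP; lra.
have [|x /andP[x1 x2] xs] := IH ((a + b) / 2) b; first by lra.
exists x; first by apply/andP; split; lra.
by rewrite inE negb_or xs andbT; apply/eqP; lra.
Qed.

(** The o-minimality of the line: an infinite set has a point off the finitely many breakpoints, and
    membership is constant near that point. *)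
Lemma infinite_interval (P : (nat -> R) -> Prop) rho : definable P ->
  infinite (fun t => P (scons t rho)) ->
  exists a b, a < b /\ forall t, a < t < b -> P (scons t rho).
Proof.
move=> /definable_breakpoints[Z [_ /(_ rho)[s hs] hZ]] /(_ s)[x Px /seq_gap[d d0 hd]].
exists (x - d), (x + d); split; first by lra.
move=> t /andP[t1 t2].
have nZ z : x - d <= z <= x + d -> ~ Z z rho.
  by move=> hz /hs zs; have := hd z hz; rewrite zs.
have [xt|tx] := leP x t.
  apply/(hZ _ x t xt) => // z /andP[z1 z2]; apply: nZ; apply/andP; split; lra.
apply/(hZ _ t x (ltW tx)) => // z /andP[z1 z2]; apply: nZ; apply/andP; split; lra.
Qed.

(** Being infinite is first-order here, since it amounts to containing an interval. *)
Lemma definable_infinite (P : R -> (nat -> R) -> Prop) :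
  definable (fun rho => P (rho 0%N) (fun i => rho i.+1)) ->
  definable (fun rho => infinite (fun x => P x rho)).
Proof.
move=> hP.
have hI : definable (fun rho => exists a, exists b,
    a < b /\ forall t, a < t -> t < b -> P t rho).
  apply: (definable_ex (P := fun a rho => exists b,
    a < b /\ forall t, a < t -> t < b -> P t rho)).
  apply: (definable_ex (P := fun b rho =>
    rho 0%N < b /\ forall t, rho 0%N < t -> t < b -> P t (fun i => rho i.+1))).
  apply: definable_and; first by apply: definable_lt; exact: polyfun_var.
  apply: (definable_forall (P := fun t rho =>
    rho 1%N < t -> t < rho 0%N -> P t (fun i => rho i.+2))).
  do 2?[apply: definable_imp; first by apply: definable_lt; exact: polyfun_var].
  apply: (definable_iff (definable_rename
    (fun i => if i is j.+1 then j.+3 else 0%N) hP)) => rho.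
  by [].
apply: (definable_iff hI) => rho; split.
  move=> [a [b [ab h]]]; apply: infinite_sub (infinite_itv ab) => x /andP[h1 h2].
  exact: h.
move=> /(infinite_interval hP)[a [b [ab h]]]; exists a, b; split=> // t h1 h2.
by apply: h; rewrite h1 h2.
Qed.

(* A polynomial vanishing on infinitely many vertical lines vanishes on every
   horizontal line, hence everywhere. *)
Lemma infinite_exchange (P : (nat -> R) -> Prop) rho : definable P ->
  infinite (fun x => infinite (fun y => P (scons x (scons y rho)))) ->
  infinite (fun y => infinite (fun x => P (scons x (scons y rho)))).
Proof.
move=> dP hP; apply: contrapT => /existsNP[s hs].
have finy y : y \notin s -> ~ infinite (fun x => P (scons x (scons y rho))).
  by move=> ys h; apply: hs; exists y.
have [N [p [hp hN]]] := definable_signs dP.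
(* For y outside [s] only finitely many x satisfy P. If no polynomial vanished at x without
   vanishing on the whole horizontal line, P would hold on an interval around x. *)
have zero x y : P (scons x (scons y rho)) -> y \notin s ->
    exists2 i, (i < N)%N & p i (scons x (scons y rho)) = 0 /\
      exists u, p i (scons u (scons y rho)) <> 0.
  move=> Pxy ys; apply: contrapT => noz; apply: (finy y ys).
  suff [a [b [ab h]]] : exists a b, a < b /\
      forall t, a < t < b -> P (scons t (scons y rho)).
    by apply: infinite_sub (infinite_itv ab).
  (* A common radius for the first n polynomials: each of them is zero on the whole line or nonzero
     at x. *)
  have {noz} : forall n, (n <= N)%N -> exists2 d, 0 < d & forall t,
      x - d < t < x + d -> forall i, (i < n)%N ->
      Num.sg (p i (scons x (scons y rho))) = Num.sg (p i (scons t (scons y rho))).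
    elim=> [_|n IH nN]; first by exists 1.
    have [d d0 hd] := IH (ltnW nN).
    suff [e e0 he] : exists2 e, 0 < e & forall t, x - e < t < x + e ->
        Num.sg (p n (scons x (scons y rho))) = Num.sg (p n (scons t (scons y rho))).
      exists (Num.min d e); first by rewrite lt_min d0.
      have hmd : Num.min d e <= d by rewrite ge_min lexx.
      have hme : Num.min d e <= e by rewrite ge_min lexx orbT.
      move=> t /andP[t1 t2] i; rewrite ltnS leq_eqVlt => /orP[/eqP->|].
        by apply: he; apply/andP; split; lra.
      by apply: hd; apply/andP; split; lra.
    have [[u pu]|h] := EM (exists u, p n (scons u (scons y rho)) <> 0); last first.
      exists 1 => // t _.
      have pz v : p n (scons v (scons y rho)) = 0.
        by apply: contrapT => ?; apply: h; exists v.
      by rewrite !pz.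
    have [s' hs'] := polyfun_finite_roots (hp n) pu.
    have xs' : p n (scons x (scons y rho)) <> 0.
      by move=> px; apply: noz; exists n => //; split=> //; exists u.
    have [q hq] := polyfun_line (scons y rho) (hp n).
    have /seq_gap[e e0 he] : x \notin polyrcf.rootsR q.
      have q0 : q != 0 by apply/eqP => q0; apply: xs'; rewrite hq q0 horner0.
      have := polyrcf.roots_on_rootsR q0 x.
      by rewrite /= rootE -hq => <-; apply/eqP.
    exists e => // t /andP[t1 t2].
    have nr z : x - e <= z <= x + e -> p n (scons z (scons y rho)) <> 0.
      move=> /he + pz; have q0 : q != 0.
        by apply/eqP => q0; apply: xs'; rewrite hq q0 horner0.
      by rewrite -(polyrcf.roots_on_rootsR q0 z) /= rootE -hq pz eqxx.
    have [xt|tx] := leP x t.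
      apply: polyfun_sgr_const => // z u' /andP[z1 z2] pz.
      by case: (nr z) => //; apply/andP; split; lra.
    apply/esym/polyfun_sgr_const => //; first exact: ltW.
    move=> z u' /andP[z1 z2] pz.
    by case: (nr z) => //; apply/andP; split; lra.
  move=> /(_ N (leqnn N))[d d0 hd]; exists (x - d), (x + d); split; first by lra.
  by move=> t /hd e; apply/(hN _ _ e).
(* Pigeonhole over the polynomials: one of them has infinitely many zeros on the vertical line
   through x, so it vanishes on all of it. *)
have hx x : infinite (fun y => P (scons x (scons y rho))) ->
    exists2 i, (i < N)%N & (forall y, p i (scons x (scons y rho)) = 0) /\
      exists y u, p i (scons u (scons y rho)) <> 0.
  move=> h.
  have {}h : infinite (fun y => exists2 i, (i < N)%N &
    p i (scons x (scons y rho)) = 0 /\ exists u, p i (scons u (scons y rho)) <> 0).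
    move=> s'; have [y Py] := h (s ++ s'); rewrite mem_cat negb_or => /andP[ys ys'].
    by exists y => //; exact: zero.
  have [i iN hi] := infinite_has h; exists i => //; split; last first.
    by have [y [_ [u pu]]] := infinite_ex hi; exists y, u.
  move=> y; apply: contrapT => py.
  pose sw j := if j is k.+2 then k.+2 else (1 - j)%N.
  have hq : polyfun (fun rho => p i (fun j => rho (sw j))).
    by apply: (@polyfun_subst _ _ (fun j rho => rho (sw j))) => // j;
      exact: polyfun_var.
  have E a b : (fun j => scons a (scons b rho) (sw j)) = scons b (scons a rho).
    by apply/funext => -[|[|j]].
  have := @polyfun_finite_roots _ (scons x rho) y hq; rewrite E => /(_ py)[s' hs'].
  have [z [pz _]] := hi s'; apply/negP; rewrite negbK; apply: hs'; by rewrite E.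
(* A second pigeonhole gives one polynomial for infinitely many x; it has too many roots on a
   horizontal line on which it is not zero. *)
have [i iN hi] := infinite_has (infinite_sub hx hP).
have [x0 [_ [y [u pu]]]] := infinite_ex hi.
have [s' hs'] := polyfun_finite_roots (hp i) pu.
have [x [px _]] := hi s'; apply/negP; rewrite negbK; exact: hs'.
Qed.

(** A substitute for completeness: a definable down-set can only end at a breakpoint. *)
Lemma definable_sup (P : (nat -> R) -> Prop) rho a b : definable P ->
  P (scons a rho) -> ~ P (scons b rho) ->
  (forall s t, s <= t -> P (scons t rho) -> P (scons s rho)) ->
  exists c, (forall t, t < c -> P (scons t rho)) /\
            (forall t, c < t -> ~ P (scons t rho)).
Proof.
move=> dP Pa Pb down.
have [Z [_ /(_ rho)[s hs] hZ]] := definable_breakpoints dP.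
(* Each breakpoint between c and d replaces one of these ends, according to whether P holds there,
   until none is left inside. *)
suff [c [d [Pc Pd cd]]] : exists c d, [/\ P (scons c rho), ~ P (scons d rho) &
    forall z, c < z < d -> z \notin s].
  have lt_cd : c < d by rewrite ltNge; apply/negP => /down /(_ Pc).
  have mid x y : c < x < d -> c < y < d -> P (scons x rho) -> P (scons y rho).
    move=> /andP[x1 x2] /andP[y1 y2] Px; have [xy|yx] := leP x y; last first.
      exact: down (ltW yx) Px.
    apply/(hZ rho x y xy) => // z /andP[z1 z2] /hs; apply/negP/cd.
    by apply/andP; split; lra.
  (* P is constant on ]c, d[, so the midpoint decides whether the cut is d or c. *)
  have [Pm|Pm] := EM (P (scons ((c + d) / 2) rho)).
    exists d; split=> t td; last by move=> /(down _ _ (ltW td)).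
    have [tc|ct] := leP t c; first exact: down Pc.
    by apply: mid Pm; apply/andP; split; lra.
  exists c; split=> t tc; first exact: down (ltW tc) Pc.
  move=> Pt; have [td|dt] := ltP t d; last by apply: Pd; exact: down Pt.
  by apply: Pm; apply: mid Pt; apply/andP; split; lra.
elim: s {hs} => [|z s [c [d [Pc Pd h]]]]; first by exists a, b.
have [Pz|Pz] := EM (P (scons z rho)).
- exists (Num.max c z), d; split=> // [|y].
    by rewrite /Num.max; case: ifP.
  rewrite gt_max => /andP[/andP[y1 y2] y3]; rewrite inE negb_or h ?y1// andbT.
  by rewrite gt_eqF.
- exists c, (Num.min d z); split=> // [|y].
    by rewrite /Num.min; case: ifP.
  rewrite lt_min => /andP[y1 /andP[y2 y3]]; rewrite inE negb_or h ?y1// andbT.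
  by rewrite lt_eqF.
Qed.

End Line.

(** * Dimension *)

Section Dimension.
Variable R : rcfType.
Implicit Types (rho : nat -> R) (P Q : seq R -> Prop).

(* [qdim n k P]: in a prefix of n quantifiers "there exists" or "there exist
   infinitely many", applied to P, k of the second kind can be used (the kinds
   may depend on the values of the previous variables). *)
Fixpoint qdim (n k : nat) (P : seq R -> Prop) : Prop :=
  if n is n'.+1 then
    (exists t, qdim n' k (fun s => P (t :: s))) \/
    (if k is k'.+1 then infinite (fun t => qdim n' k' (fun s => P (t :: s)))
     else False)
  else k = 0%N /\ P [::].

Lemma qdimSS n k P : qdim n.+1 k.+1 P ->
  (exists t, qdim n k.+1 (fun s => P (t :: s))) \/
  infinite (fun t => qdim n k (fun s => P (t :: s))).
Proof. by []. Qed.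

Lemma mkseq_cons (v : nat -> R) n : mkseq v n.+1 = v 0%N :: mkseq (v \o succn) n.
Proof. by rewrite /mkseq /= (iotaDl 1) -map_comp. Qed.

Definition definable_on n P := definable (fun rho => P (mkseq rho n)).

Lemma definable_qdim n k (P : (nat -> R) -> seq R -> Prop) :
  definable (fun rho => P (fun i => rho (n + i)%N) (mkseq rho n)) ->
  definable (fun rho => qdim n k (P rho)).
Proof.
elim: n k P => [|n IH] k P hP.
  by apply: definable_and => //; exact: definable_const.
have hP' : definable (fun rho => P (fun i => rho (n + i).+1)
    (rho n :: mkseq rho n)).
  pose g i := if i == 0%N then n else if (i <= n)%N then i.-1 else i.
  apply: (definable_iff (definable_rename g hP)) => rho.
  suff -> : mkseq (fun i => rho (g i)) n.+1 = rho n :: mkseq rho n.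
    suff -> : (fun i => rho (g (n.+1 + i)%N)) = (fun i => rho (n + i).+1) by [].
    by apply/funext => i; rewrite /g addSn /= ltnNge leq_addr.
  rewrite mkseq_cons /=; congr (_ :: _); apply/eq_in_map => i.
  by rewrite mem_iota add0n /g /= => ->.
apply: definable_or.
  apply: (definable_ex (P := fun t rho => qdim n k (fun s => P rho (t :: s)))).
  apply: (IH k (fun rho s => P (fun i => rho i.+1) (rho 0%N :: s))).
  apply: (definable_iff hP') => rho; rewrite addn0.
  suff -> : (fun i => rho (n + i).+1) = (fun i => rho (n + i.+1)%N) by [].
  by apply/funext => i; rewrite addnS.
case: k => [|k]; first exact: definable_const.
apply: (definable_infinite (P := fun t rho => qdim n k (fun s => P rho (t :: s)))).
apply: (IH k (fun rho s => P (fun i => rho i.+1) (rho 0%N :: s))).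
apply: (definable_iff hP') => rho; rewrite addn0.
suff -> : (fun i => rho (n + i).+1) = (fun i => rho (n + i.+1)%N) by [].
by apply/funext => i; rewrite addnS.
Qed.

Lemma definable_on_cons n P t :
  definable_on n.+1 P -> definable_on n (fun s => P (t :: s)).
Proof.
move=> hP; pose sigma i := if i is j.+1 then fun rho : nat -> R => rho j
  else fun=> t.
have hs i : polyfun (sigma i).
  by case: i => [|i]; [exact: polyfun_cst|exact: polyfun_var].
by apply: (definable_iff (definable_subst hs hP)) => rho; rewrite mkseq_cons.
Qed.

Lemma definable_on_reindex n P (f : seq R -> seq R) (g : nat -> nat) :
  (forall v, f (mkseq v n) = mkseq (fun i => v (g i)) n) ->
  definable_on n P -> definable_on n (fun s => P (f s)).
Proof.
move=> fg hP.
by apply: (definable_iff (definable_rename g hP)) => rho; rewrite fg.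
Qed.

Lemma qdim_cons n k P Q :
  (forall t j, qdim n j (fun s => P (t :: s)) ->
    qdim n j (fun s => Q (t :: s))) -> qdim n.+1 k P -> qdim n.+1 k Q.
Proof.
move=> PQ [[t h]|]; first by left; exists t; exact: PQ.
by case: k => // k h; right; apply: infinite_sub h => t; exact: PQ.
Qed.

Lemma qdim_sub n k P Q :
  (forall s, size s = n -> P s -> Q s) -> qdim n k P -> qdim n k Q.
Proof.
elim: n k P Q => [|n IH] k P Q PQ; first by case=> -> h; split=> //; exact: PQ.
by apply: qdim_cons => t j; apply: IH => s hs; apply: PQ; rewrite /= hs.
Qed.

Lemma qdim_leq n k P : qdim n k P -> (k <= n)%N.
Proof.
elim: n k P => [|n IH] k P; first by case=> ->.
case=> [[t /IH h]|]; first exact: leqW.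
by case: k => // k /infinite_ex[t /IH].
Qed.

Lemma qdim_nonempty n k P : qdim n k P -> exists2 s, size s = n & P s.
Proof.
elim: n k P => [|n IH] k P; first by case=> _ h; exists [::].
case=> [[t /IH[s hs Ps]]|]; first by exists (t :: s); rewrite //= hs.
case: k => // k /infinite_ex[t /IH[s hs Ps]].
by exists (t :: s); rewrite //= hs.
Qed.

Lemma qdim0 n P s : size s = n -> P s -> qdim n 0 P.
Proof.
elim: n P s => [|n IH] P s; first by move=> /size0nil ->.
by case: s => //= t s [hs] Ps; left; exists t; exact: IH hs Ps.
Qed.

(** * Permutation of the quantified coordinates *)

Definition swap2 (s : seq R) := if s is x :: y :: s' then y :: x :: s' else s.

(** Mixed prefixes are swapped by hand or by a pigeonhole; only two infinite quantifiers in a row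
    call for [infinite_exchange], and hence for definability. *)
Lemma qdim_swap2 n k P : definable_on n.+2 P ->
  qdim n.+2 k P -> qdim n.+2 k (fun s => P (swap2 s)).
Proof.
move=> dP [[x [[y h]|]]|].
- by left; exists y; left; exists x.
- by case: k => // k h; right; apply: infinite_sub h => y h; left; exists x.
case: k => // k; rewrite -/qdim => /infinite_or[].
  move=> h.
  (* Either one y serves infinitely many x, or no finite list of y can serve all the x; in the
     second case the infinite quantifier passes from x to y. *)
  have [[y hy]|nh] := EM (exists y, infinite (fun x =>
    qdim n k (fun s => P (x :: y :: s)))); first by left; exists y; right.
  right=> s; apply: contrapT => hs.
  have : infinite (fun x => exists2 i, (i < size s)%N &
      qdim n k (fun s' => P (x :: s`_i :: s'))).
    apply: infinite_sub h => x [y hy].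
    have [ys|ys] := boolP (y \in s).
      by exists (index y s); rewrite ?index_mem// nth_index.
    by case: hs; exists y => //; left; exists x.
  by move=> /infinite_has[i _ hi]; apply: nh; exists s`_i.
case: k => [|k h]; first by move=> /infinite_ex[].
right; pose D rho := qdim n k (fun s => P (rho 0%N :: rho 1%N :: s)).
have dD : definable D.
  apply: (@definable_qdim n k (fun rho s => P (rho 0%N :: rho 1%N :: s))).
  pose g i := if i == 0%N then n else if i == 1%N then n.+1 else i.-2.
  apply: (definable_iff (definable_rename g dP)) => rho.
  by rewrite !mkseq_cons /= addn0 addn1.
apply: infinite_sub (infinite_exchange (rho := fun=> 0) dD h) => y hy.
by right.
Qed.

Definition insert_at i (s : seq R) :=
  if s is x :: s' then take i s' ++ x :: drop i s' else [::].

Lemma definable_on_insert_at n i P : (i <= n)%N ->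
  definable_on n.+1 P -> definable_on n.+1 (fun s => P (insert_at i s)).
Proof.
move=> hi; apply: (definable_on_reindex (g := fun j =>
  if (j < i)%N then j.+1 else if j == i then 0%N else j)) => v.
have hsz : size (mkseq (v \o succn) n) = n by rewrite size_mkseq.
rewrite mkseq_cons; apply: (@eq_from_nth _ 0) => [|j].
  by rewrite size_cat size_takel ?hsz//= size_drop hsz size_map size_iota; lia.
rewrite /= size_cat /= size_takel ?size_drop ?hsz// => hj.
have jn : (j < n.+1)%N by lia.
rewrite (nth_mkseq _ _ jn) nth_cat size_takel ?hsz//.
case: ltnP => hji; first by rewrite nth_take// nth_mkseq//; lia.
case: eqVneq => [->|ji]; first by rewrite subnn.
have -> : (j - i = (j - i).-1.+1)%N by lia.
by rewrite /= nth_drop nth_mkseq /=; [congr v; lia|lia].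
Qed.

(** By i adjacent swaps. Any coordinate may thus be the one quantified first. *)
Lemma qdim_insert_at n k i P : definable_on n.+1 P -> (i <= n)%N ->
  qdim n.+1 k (fun s => P (insert_at i s)) -> qdim n.+1 k P.
Proof.
elim: i n k P => [|i IH] n k P dP.
  by move=> _; apply: qdim_sub => -[//|x s] _; rewrite /= take0 drop0.
case: n dP => // n dP hi h.
have := qdim_swap2 (definable_on_insert_at (i := i.+1) _ dP) h.
move=> /(_ hi); apply: qdim_cons => a j {}h.
apply: (IH n j (fun s => P (a :: s)) (definable_on_cons a dP) hi).
by apply: qdim_sub h => -[//|x s].
Qed.

Lemma qdim_rot n k m P : definable_on n P -> (m <= n)%N ->
  qdim n k (fun s => P (rot m s)) -> qdim n k P.
Proof.
elim: m P => [|m IH] P dP.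
  by move=> _; apply: qdim_sub => s _; rewrite rot0.
case: n dP IH => // n dP IH hm h.
have rot1E s : size s = n.+1 -> rot 1 s = insert_at n s.
  by case: s => // x s [hs]; rewrite rot1_cons /= take_oversize ?drop_oversize ?hs// cats1.
have dP1 := definable_on_insert_at (leqnn n) dP.
apply: (qdim_insert_at dP (leqnn n)).
apply: (IH (fun s => P (insert_at n s)) dP1 (ltnW hm)).
apply: qdim_sub h => s hs; rewrite -rot1E ?size_rot//.
by rewrite -rotS ?hs.
Qed.

(** Plain existential quantifiers suffice for the appended coordinates, hence the same k. *)
Lemma qdim_cat n m k P Q :
  (forall s, size s = n -> P s -> exists2 u, size u = m & Q (s ++ u)) ->
  qdim n k P -> qdim (n + m) k Q.
Proof.
elim: n k P Q => [|n IH] k P Q PQ.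
  by case=> -> /(PQ [::] erefl)[u hu Qu]; exact: qdim0 hu Qu.
rewrite addSn; move=> [[t h]|].
  by left; exists t; apply: IH h => s hs; apply: (PQ (t :: s)); rewrite /= hs.
case: k => // k h; right; apply: infinite_sub h => t.
by apply: IH => s hs; apply: (PQ (t :: s)); rewrite /= hs.
Qed.

Lemma qdim_box n (I : nat -> R -> Prop) P :
  (forall j, (j < n)%N -> infinite (I j)) ->
  (forall s, size s = n -> (forall j, (j < n)%N -> I j s`_j) -> P s) ->
  qdim n n P.
Proof.
elim: n I P => [|n IH] I P hI hP; first by split=> //; exact: hP.
right; apply: infinite_sub (hI 0%N isT) => t It.
apply: (IH (fun j => I j.+1)) => [j|s hs hj]; first exact: (hI j.+1).
by apply: hP => [|[|j]//]; [rewrite /= hs|exact: hj].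
Qed.

Lemma qdim_rcons n k P Q :
  (forall s, size s = n -> P s -> infinite (fun t => Q (rcons s t))) ->
  qdim n k P -> qdim n.+1 k.+1 Q.
Proof.
elim: n k P Q => [|n IH] k P Q PQ.
  by case=> -> /(PQ [::] erefl) h; right; apply: infinite_sub h.
case=> [[t h]|].
  by left; exists t; apply: IH h => s hs; apply: (PQ (t :: s)); rewrite /= hs.
case: k => // k h; right; apply: infinite_sub h => t.
by apply: IH => s hs; apply: (PQ (t :: s)); rewrite /= hs.
Qed.

Lemma qdim_subsingleton m k P :
  (forall u v, size u = m -> size v = m -> P u -> P v -> u = v) ->
  qdim m k P -> k = 0%N.
Proof.
elim: m k P => [|m IH] k P hP; first by case.
case=> [[t]|].
  apply: IH => u v hu hv Pu Pv.
  by have [] := hP (t :: u) (t :: v) (congr1 succn hu) (congr1 succn hv) Pu Pv.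
case: k => // k h; have [t /qdim_nonempty[u hu Pu]] := infinite_ex h.
have [t' /qdim_nonempty[v hv Pv]] := h [:: t].
have [->] := hP (t :: u) (t' :: v) (congr1 succn hu) (congr1 succn hv) Pu Pv.
by rewrite mem_head.
Qed.

(** Coordinates determined by the preceding ones leave no room for an infinite quantifier, so
    projecting them away keeps k. Together with [qdim_rot] this gives invariance under injective
    maps. *)
Lemma qdim_functional n m k P :
  (forall s u v, size s = n -> size u = m -> size v = m ->
    P (s ++ u) -> P (s ++ v) -> u = v) ->
  qdim (n + m) k P ->
  qdim n k (fun s => exists2 u, size u = m & P (s ++ u)).
Proof.
elim: n k P => [|n IH] k P hP h.
  have k0 := qdim_subsingleton (fun u v => hP [::] u v erefl) h.
  by split=> //; exact: qdim_nonempty h.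
have hP' t : forall s u v, size s = n -> size u = m -> size v = m ->
    P (t :: s ++ u) -> P (t :: s ++ v) -> u = v.
  by move=> s u v hs; apply: (hP (t :: s)); rewrite /= hs.
move: h; rewrite addSn => -[[t h]|].
  by left; exists t; exact: IH (hP' t) h.
case: k => // k h; right; apply: infinite_sub h => t.
exact: IH (hP' t).
Qed.

(** The first coordinate takes finitely many values, and over each of them the fiber is finite by
    induction. *)
Lemma qdim_finite n P : ~ qdim n 1 P ->
  exists L : seq (seq R), forall s, size s = n -> P s -> s \in L.
Proof.
elim: n P => [|n IH] P hP.
  by exists [:: [::]] => s /size0nil ->.
have [hP' /existsNP[T hT]] : (~ exists t, qdim n 1 (fun s => P (t :: s))) /\
    ~ infinite (fun t => qdim n 0 (fun s => P (t :: s))).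
  by split=> h; apply: hP; [left|right].
have {}hT t : qdim n 0 (fun s => P (t :: s)) -> t \in T.
  by move=> h; apply: contrapT => /negP tT; apply: hT; exists t.
suff [L hL] : exists L : seq (seq R), forall t s, t \in T -> size s = n ->
    P (t :: s) -> t :: s \in L.
  exists L => -[//|t s] [hs] Ps; apply: hL => //.
  by apply: hT; exact: qdim0 hs Ps.
elim: T {hT} => [|t T [L hL]]; first by exists [::].
have [L' hL'] := IH (fun s => P (t :: s)) (fun h => hP' (ex_intro _ t h)).
exists ([seq t :: s | s <- L'] ++ L) => t' s; rewrite inE mem_cat.
case: eqVneq => [->|_] /= tT hs Ps; last by rewrite hL ?orbT.
by rewrite map_f ?hL'.
Qed.

(** With n + 1 quantifiers and count n + 1 all of them are infinite; the first n are then
    instantiated. *)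
Lemma qdim_full n P : qdim n.+1 n.+1 P ->
  exists2 s, size s = n & infinite (fun t => P (rcons s t)).
Proof.
elim: n P => [|n IH] P.
  case=> [[t []//]|h]; exists [::] => //.
  by apply: infinite_sub h => t [].
move=> /qdimSS[[t /qdim_leq]|/infinite_ex[t /IH[s hs h]]]; first by rewrite ltnn.
by exists (t :: s); rewrite /= ?hs.
Qed.

End Dimension.

(** * Definable choice and embeddings of cubes *)

Section Embedding.
Variable R : rcfType.
Implicit Types (rho : nat -> R).

Definition definable_fun (c : (nat -> R) -> R) :=
  definable (fun rho => rho 0%N = c (fun i => rho i.+1)).

Lemma definable_fun_subst (P : R -> (nat -> R) -> Prop) c : definable_fun c ->
  definable (fun rho => P (rho 0%N) (fun i => rho i.+1)) ->
  definable (fun rho => P (c rho) rho).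
Proof.
move=> hc hP.
apply: (definable_iff (definable_ex (P := fun t rho => t = c rho /\ P t rho)
  (definable_and hc hP))) => rho.
by split=> [[t [->]]//|h]; exists (c rho).
Qed.

Lemma definable_fun_rename (c : (nat -> R) -> R) (g : nat -> nat) :
  definable_fun c -> definable_fun (fun rho => c (fun i => rho (g i))).
Proof.
exact: (definable_rename (fun i => if i is j.+1 then (g j).+1 else 0%N)).
Qed.

Lemma definable_fun_if (A : (nat -> R) -> Prop) (c d : (nat -> R) -> R) :
  definable A -> definable_fun c -> definable_fun d ->
  definable_fun (fun rho => if pselect (A rho) then c rho else d rho).
Proof.
move=> hA hc hd; have {}hA := definable_rename succn hA.
apply: (definable_iff (definable_or (definable_and hA hc)
  (definable_and (definable_not hA) hd))) => rho.
by rewrite /=; case: pselect => h /=; tauto.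
Qed.

Lemma seq_min (s : seq R) (C : R -> Prop) : (exists2 t, t \in s & C t) ->
  exists t, [/\ t \in s, C t & forall u, u \in s -> C u -> t <= u].
Proof.
elim: s => [[t]//|x s IH [t]].
have [[y ys Cy]|h] := EM (exists2 y, y \in s & C y); last first.
  rewrite inE => /predU1P[-> Cx|ts Ct]; last by case: h; exists t.
  exists x; rewrite mem_head; split=> // u; rewrite inE => /predU1P[->//|us Cu].
  by case: h; exists u.
have [z [zs Cz hz]] := IH (ex_intro2 _ _ y ys Cy).
have [[Cx xz]|h] := EM (C x /\ x < z).
  move=> _ _; exists x; rewrite mem_head; split=> // u.
  rewrite inE => /predU1P[->//|us /(hz _ us)]; apply: le_trans.
  exact: ltW.
move=> _ _; exists z; rewrite inE zs orbT; split=> // u.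
rewrite inE => /predU1P[->|us /(hz _ us)//] Cx.
by rewrite leNgt; apply/negP => xz; apply: h.
Qed.

Lemma seq_max (s : seq R) (C : R -> Prop) : (exists2 t, t \in s & C t) ->
  exists t, [/\ t \in s, C t & forall u, u \in s -> C u -> u <= t].
Proof.
move=> [t ts Ct].
have [|z [/mapP[y ys ->]]] := @seq_min [seq - x | x <- s] (fun x => C (- x)).
  by exists (- t); rewrite ?opprK // map_f.
rewrite opprK => Cy hy; exists y; split=> // u us Cu.
by rewrite -lerN2 hy ?opprK// map_f.
Qed.

(** The complement of the breakpoints has finitely many components, and each contains the midpoint
    of two breakpoints, a breakpoint moved by 1, or 0. These candidates form a finite definable set,
    and the least one satisfying P is selected. *)
Lemma definable_choice (P : R -> (nat -> R) -> Prop) :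
  definable (fun rho => P (rho 0%N) (fun i => rho i.+1)) ->
  exists c, definable_fun c /\ forall rho, (exists t, P t rho) -> P (c rho) rho.
Proof.
move=> hP; have [Z [dZ finZ constZ]] := definable_breakpoints hP.
(* The case z = z' puts the breakpoints themselves among the candidates; 0 serves when there are no
   breakpoints. *)
pose C t rho := P t rho /\ (t = 0 \/ exists z, Z z rho /\ exists z', Z z' rho /\
  (t = z + 1 \/ t = z - 1 \/ t + t = z + z')).
have dC : definable (fun rho => C (rho 0%N) (fun i => rho i.+1)).
  apply: definable_and => //; apply: definable_or.
    by apply: definable_eq; [exact: polyfun_var|exact: polyfun_cst].
  apply: (definable_ex (P := fun z rho => Z z (fun i => rho i.+1) /\
    exists z', Z z' (fun i => rho i.+1) /\
    (rho 0%N = z + 1 \/ rho 0%N = z - 1 \/ rho 0%N + rho 0%N = z + z'))).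
  apply: definable_and.
    exact: (definable_rename (fun i => if i is j.+1 then j.+2 else 0%N) dZ).
  apply: (definable_ex (P := fun z' rho => Z z' (fun i => rho i.+2) /\
    (rho 1%N = rho 0%N + 1 \/ rho 1%N = rho 0%N - 1 \/
     rho 1%N + rho 1%N = rho 0%N + z'))).
  apply: definable_and.
    exact: (definable_rename (fun i => if i is j.+1 then j.+3 else 0%N) dZ).
  by do ?apply: definable_or; apply: definable_eq;
    do ?[exact: polyfun_var|exact: polyfun_cst|apply: polyfunD].
have finC rho : exists s : seq R, forall t, C t rho -> t \in s.
  have [s hs] := finZ rho.
  exists (0 :: [seq z + 1 | z <- s] ++ [seq z - 1 | z <- s] ++
    [seq (z + z') / 2 | z <- s, z' <- s]) => t [_].
  rewrite inE !mem_cat; case=> [->|[z [/hs zs [z' [/hs zs']]]]]; first by rewrite eqxx.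
  case=> [->|[->|h]]; first by rewrite (map_f (fun z => z + 1)) ?orbT.
    by rewrite (map_f (fun z => z - 1)) ?orbT.
  have -> : t = (z + z') / 2 by lra.
  by rewrite (allpairs_f (fun x y => (x + y) / 2)) ?orbT.
have exC rho : (exists t, P t rho) -> exists t, C t rho.
  move=> [t Pt]; have [s hs] := finZ rho.
  have [Zt|Zt] := EM (Z t rho).
    by exists t; split=> //; right; exists t; split=> //; exists t; split; auto.
  (* P passes from t to u when no breakpoint separates them; u is then chosen by the nearest
     breakpoints on either side of t. *)
  have key u : (forall z, Z z rho -> ~ (t <= z <= u)) ->
      (forall z, Z z rho -> ~ (u <= z <= t)) -> P u rho.
    move=> h1 h2; have [tu|ut] := leP t u.
      by apply/(constZ rho t u tu) => // z /[swap] /h1.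
    by apply/(constZ rho u t (ltW ut)) => // z /[swap] /h2.
  have neqt z : Z z rho -> z <> t by move=> + zt; rewrite zt.
  have [hl|hl] := EM (exists2 z, z \in s & Z z rho /\ z < t);
  have [hr|hr] := EM (exists2 z, z \in s & Z z rho /\ t < z).
  - have [zl [_ [Zl lt_l] ml]] := seq_max hl.
    have [zr [_ [Zr lt_r] mr]] := seq_min hr.
    have gap z : Z z rho -> z <= zl \/ zr <= z.
      move=> Zz; have [tz|zt|zt] := ltgtP t z; last by case: (neqt z).
        by right; apply: mr => //; exact: hs.
      by left; apply: ml => //; exact: hs.
    exists ((zl + zr) / 2); split.
      by apply: key => z /gap zz /andP[z1 z2]; lra.
    right; exists zl; split=> //; exists zr; split=> //; right; right; lra.
  - have [zl [_ [Zl lt_l] ml]] := seq_max hl.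
    have gap z : Z z rho -> z <= zl.
      move=> Zz; have [tz|zt|zt] := ltgtP t z; last by case: (neqt z).
        by case: hr; exists z; [exact: hs|].
      by apply: ml => //; exact: hs.
    exists (zl + 1); split.
      by apply: key => z /gap zz /andP[z1 z2]; lra.
    by right; exists zl; split=> //; exists zl; split; auto.
  - have [zr [_ [Zr lt_r] mr]] := seq_min hr.
    have gap z : Z z rho -> zr <= z.
      move=> Zz; have [tz|zt|zt] := ltgtP t z; last by case: (neqt z).
        by apply: mr => //; exact: hs.
      by case: hl; exists z; [exact: hs|].
    exists (zr - 1); split.
      by apply: key => z /gap zz /andP[z1 z2]; lra.
    by right; exists zr; split=> //; exists zr; split; auto.
  - have gap z : ~ Z z rho.
      move=> Zz; have [tz|zt|zt] := ltgtP t z; last by case: (neqt z).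
        by case: hr; exists z; [exact: hs|].
      by case: hl; exists z; [exact: hs|].
    by exists 0; split; [apply: key => z /gap|left].
pose Cm t rho := C t rho /\ forall u, C u rho -> t <= u.
have dCm : definable (fun rho => Cm (rho 0%N) (fun i => rho i.+1)).
  apply: definable_and => //.
  apply: (definable_forall (P := fun u rho => C u (fun i => rho i.+1) -> rho 0%N <= u)).
  apply: definable_imp.
    exact: (definable_rename (fun i => if i is j.+1 then j.+2 else 0%N) dC).
  by apply: definable_le; exact: polyfun_var.
have exCm rho : (exists t, P t rho) -> exists t, Cm t rho.
  move=> /exC[t Ct]; have [s hs] := finC rho.
  have [|m [_ Cmm hm]] := @seq_min s (C^~ rho); first by exists t; [exact: hs|].
  by exists m; split=> // u Cu; apply: hm => //; exact: hs.
have uniqCm rho t u : Cm t rho -> Cm u rho -> t = u.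
  by move=> [Ct ht] [Cu hu]; apply/le_anti; rewrite ht ?hu.
(* Where there is no candidate the value is 0, which keeps the graph definable. *)
exists (fun rho => xget 0 [set t | Cm t rho]); split; last first.
  by move=> rho /exCm[t ht]; have [] := xgetPex 0 (ex_intro [set t | Cm t rho] t ht) => -[].
have dex := definable_ex (P := Cm) dCm.
have dex' := definable_not (definable_rename succn dex).
apply: (definable_iff (definable_or dCm (definable_and dex'
  (definable_eq (polyfun_var _ 0%N) (polyfun_cst 0))))) => rho.
case: xgetP => [t -> /= ht|nC]; split.
- case=> [h|[h _]]; first exact: (uniqCm _ _ _ h ht).
  by case: h; eexists; exact: ht.
- by move=> ->; left.
- by case=> [h|[_ //]]; case: (nC _ h).
- by move=> h; right; split=> // -[u hu]; exact: nC hu.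
Qed.

Definition in_cube k (x : seq R) := size x = k /\ {in x, forall t, 0 < t < 1}.

(** The prefix becomes an embedding: definable choice answers a plain quantifier, and an infinite
    one provides an interval onto which a cube coordinate is mapped. The construction is uniform in
    [rho] because the induction turns cube coordinates into parameters. *)
Lemma qdim_embed n k (P : (nat -> R) -> seq R -> Prop) :
  definable (fun rho => P (fun i => rho (n + i)%N) (mkseq rho n)) ->
  exists Phi : (nat -> R) -> seq R,
  [/\ forall rho, size (Phi rho) = n,
      forall i, definable_fun (fun rho => (Phi rho)`_i) &
      forall rho, qdim n k (P rho) ->
        (forall x, in_cube k x -> P rho (Phi (foldr (@scons R) rho x))) /\
        (forall x y, in_cube k x -> in_cube k y ->
          Phi (foldr (@scons R) rho x) = Phi (foldr (@scons R) rho y) -> x = y)].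
Proof.
have foldrk (x : seq R) rho m : size x = m ->
    (fun i => foldr (@scons R) rho x (m + i)%N) = rho.
  by move=> <-; apply/funext => i; elim: x => //= a x IH.
elim: n k P => [|n IH] k P hP.
  exists (fun=> [::]); split=> //.
    by move=> i; rewrite /definable_fun; apply: definable_eq; 
      [exact: polyfun_var|rewrite nth_nil; exact: polyfun_cst].
  move=> rho [-> h]; split=> [//|x y [/size0nil -> _] [/size0nil -> _]] //.
have hPt : definable (fun rho => P (fun i => rho (n + i.+1)%N)
    (rho 0%N :: mkseq (rho \o succn) n)).
  apply: (definable_iff hP) => rho; rewrite mkseq_cons.
  suff -> : (fun i => rho (n.+1 + i)%N) = (fun i => rho (n + i.+1)%N) by [].
  by apply/funext => i; rewrite addSnnS.
have hPq j : definable (fun rho =>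
    qdim n j (fun s => P (fun i => rho i.+1) (rho 0%N :: s))).
  apply: (@definable_qdim _ n j (fun rho s => P (fun i => rho i.+1) (rho 0%N :: s))).
  pose g i := if i == 0%N then n else if (i <= n)%N then i.-1 else i.
  apply: (definable_iff (definable_rename g hPt)) => rho /=.
  suff -> : (fun i => rho (g (n + i.+1)%N)) = (fun i => rho (n + i.+1)%N).
    suff -> : mkseq ((fun i => rho (g i)) \o succn) n = mkseq rho n.
      by rewrite addn0.
    by apply/eq_in_map => i; rewrite mem_iota add0n /g /= => ->.
  by apply/funext => i; rewrite /g addnS /= ltnNge leq_addr.
have hcons (c : (nat -> R) -> R) : definable_fun c ->
    definable (fun rho => P (fun i => rho (n + i)%N)
      (c (fun i => rho (n + i)%N) :: mkseq rho n)).
  move=> hc; apply: (@definable_fun_subst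
    (fun t rho => P (fun i => rho (n + i)%N) (t :: mkseq rho n))
    (fun rho => c (fun i => rho (n + i)%N))) => //.
    exact: (definable_fun_rename _ hc).
  by apply: (definable_iff hPt) => rho; 
    suff -> : (fun i => rho (n + i.+1)%N) = (fun i => rho (n + i).+1) by [];
    apply/funext => i; rewrite addnS.
have [c [dc hc]] := definable_choice
  (P := fun t rho => qdim n k (fun s => P rho (t :: s))) (hPq k).
have [PhiA [szA dA hA]] := IH k (fun rho s => P rho (c rho :: s)) (hcons c dc).
pose shift m rho : nat -> R := fun i => rho (m + i)%N.
case: k c dc hc PhiA szA dA hA => [|k] c dc hc PhiA szA dA hA.
  exists (fun rho => c rho :: PhiA rho); split=> [rho|i|rho]; rewrite /= ?szA//.
    by case: i => [|i]; [exact: dc|exact: dA].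
  case=> [/hc /hA[h1 h2]|//]; split=> x; first by case=> /size0nil -> ?; exact: (h1 [::]).
  by move=> y hx hy [_ /h2]; exact.
(* Where [A] holds, the first quantifier is plain: the first entry does not depend on the cube
   point, and all cube coordinates go to the fiber. *)
pose A rho := exists t, qdim n k.+1 (fun s => P rho (t :: s)).
have dAA : definable A := definable_ex
  (P := fun t rho => qdim n k.+1 (fun s => P rho (t :: s))) (hPq k.+1).
pose Itv a b rho := a < b /\ forall t, a < t -> t < b ->
  qdim n k (fun s => P rho (t :: s)).
have dItv : definable (fun rho => Itv (rho 1%N) (rho 0%N) (fun i => rho i.+2)).
  apply: definable_and; first by apply: definable_lt; exact: polyfun_var.
  apply: (definable_forall (P := fun t rho => rho 1%N < t -> t < rho 0%N ->
    qdim n k (fun s => P (fun i => rho i.+2) (t :: s)))).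
  do 2?[apply: definable_imp; first by apply: definable_lt; exact: polyfun_var].
  exact: (definable_rename (fun i => if i is j.+1 then j.+3 else 0%N) (hPq k)).
have [a [da ha]] := definable_choice (P := fun a rho => exists b, Itv a b rho)
  (definable_ex (P := fun b rho => Itv (rho 0%N) b (fun i => rho i.+1)) dItv).
have [b [db hb]] := definable_choice (P := fun b rho => Itv (a rho) b rho)
  (definable_fun_subst (P := fun t rho => Itv t (rho 0%N) (fun i => rho i.+1))
    (definable_fun_rename succn da)
    (definable_rename (fun i => if i is j.+2 then i else (1 - i)%N) dItv)).
(* The affine map of ]0, 1[ onto ]a, b[, applied to the last cube coordinate: in [foldr] it stands
   next to the parameters, so it can join them in the induction. *)
pose tau rho := a (shift 1%N rho) + (b (shift 1%N rho) - a (shift 1%N rho)) * rho 0%N.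
have dtau : definable_fun tau.
  apply: (@definable_fun_subst (fun t rho => rho 0%N =
    t + (b (shift 2%N rho) - t) * rho 1%N) (fun rho => a (shift 2%N rho))).
    exact: (definable_fun_rename (fun i => i.+2) da).
  apply: (@definable_fun_subst (fun t rho => rho 1%N =
    rho 0%N + (t - rho 0%N) * rho 2%N) (fun rho => b (shift 3%N rho))).
    exact: (definable_fun_rename (fun i => i.+3) db).
  apply: definable_eq; first exact: polyfun_var.
  by apply: polyfunD; [|apply: polyfunM; [apply: polyfunB|]]; exact: polyfun_var.
have dPB : definable (fun rho => P (shift 1%N (shift n rho))
    (tau (shift n rho) :: mkseq rho n)).
  apply: (@definable_fun_subst
    (fun t rho => P (shift 1%N (shift n rho)) (t :: mkseq rho n))
    (fun rho => tau (shift n rho))).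
    exact: (definable_fun_rename _ dtau).
  apply: (definable_iff (definable_rename
    (fun i => if (i <= n)%N then i else i.+1) hPt)) => rho.
  have -> : (fun i => rho (if (n + i.+1 <= n)%N then (n + i.+1)%N else (n + i.+1).+1)) =
      shift 1%N (shift n (fun i => rho i.+1)).
    by apply/funext => i; rewrite /shift ifF; [congr rho; lia|lia].
  suff -> : mkseq ((fun i => rho (if (i <= n)%N then i else i.+1)) \o succn) n =
    mkseq (fun i => rho i.+1) n by [].
  by apply/eq_in_map => i; rewrite mem_iota add0n /= => ->.
have [PhiB [szB dB hB]] := IH k (fun rho s => P (shift 1%N rho) (tau rho :: s)) dPB.
(* The test ignores the cube coordinates, so a single branch serves the whole cube and injectivity
   never compares the two. *)
exists (fun rho => if pselect (A (shift k.+1 rho))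
  then c (shift k.+1 rho) :: PhiA rho else tau (shift k rho) :: PhiB rho).
split=> [rho|i|rho h].
- by case: pselect => ?; rewrite /= ?szA ?szB.
- have dAk : definable (fun rho => A (shift k.+1 rho)).
    exact: (definable_rename _ dAA).
  have -> : (fun rho => (if pselect (A (shift k.+1 rho))
      then c (shift k.+1 rho) :: PhiA rho else tau (shift k rho) :: PhiB rho)`_i) =
    (fun rho => if pselect (A (shift k.+1 rho))
      then (c (shift k.+1 rho) :: PhiA rho)`_i
      else (tau (shift k rho) :: PhiB rho)`_i).
    by apply/funext => rho; case: pselect.
  apply: definable_fun_if => //; case: i => [|i] /=.
  + exact: (definable_fun_rename _ dc).
  + exact: dA.
  + exact: (definable_fun_rename _ dtau).
  + exact: dB.
have shiftk (x : seq R) : in_cube k.+1 x -> shift k.+1 (foldr (@scons R) rho x) = rho.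
  by move=> [hx _]; exact: foldrk.
have [hAr|hAr] := EM (A rho).
  have [h1 h2] := hA rho (hc _ hAr); split=> [x hx|x y hx hy].
    by rewrite shiftk//; case: pselect => // ?; exact: h1.
  by rewrite !shiftk//; case: pselect => // ? [/h2]; exact.
have {h} hI : Itv (a rho) (b rho) rho.
  apply: hb; apply: ha; case: h => [//|h].
  have [u [v [uv h']]] := infinite_interval (rho := rho) (hPq k) h.
  by exists u, v; split=> // t t1 t2; apply: h'; rewrite t1 t2.
have [ab hI'] := hI.
have tauE x0 : tau (scons x0 rho) = a rho + (b rho - a rho) * x0 by [].
have hdim x0 : 0 < x0 < 1 -> qdim n k (fun s =>
    P (shift 1%N (scons x0 rho)) (tau (scons x0 rho) :: s)).
  move=> /andP[x1 x2]; apply: hI'; rewrite tauE.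
    by rewrite ltrDl mulr_gt0// subr_gt0.
  have : (b rho - a rho) * x0 < b rho - a rho.
    by rewrite -[ltRHS]mulr1 ltr_pM2l// subr_gt0.
  lra.
have split_last (x : seq R) : in_cube k.+1 x -> exists x' x0,
    [/\ x = rcons x' x0, in_cube k x' & 0 < x0 < 1].
  case/lastP: x => [[]//|x' x0 [hx h]]; exists x', x0; split=> //.
    split; first by move: hx; rewrite size_rcons => -[].
    by move=> t tx; apply: h; rewrite mem_rcons inE tx orbT.
  by apply: h; rewrite mem_rcons mem_head.
have shiftr x' x0 : in_cube k x' ->
    shift k (foldr (@scons R) rho (rcons x' x0)) = scons x0 rho.
  by move=> [hx _]; rewrite foldr_rcons; exact: foldrk.
split=> [x hx|x y hx hy].
  rewrite shiftk//; case: pselect => // ?.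
  have [x' [x0 [-> hx' hx0]]] := split_last x hx.
  have [h1 _] := hB _ (hdim x0 hx0).
  by rewrite shiftr// foldr_rcons; exact: h1.
rewrite !shiftk//; case: pselect => // ?.
have [x' [x0 [-> hx' hx0]]] := split_last x hx.
have [y' [y0 [-> hy' hy0]]] := split_last y hy.
rewrite !shiftr// !foldr_rcons !tauE => -[/addrI].
have ba : b rho - a rho != 0 by rewrite subr_eq0 gt_eqF.
move=> /(mulfI ba) <-.
by have [_ h2] := hB _ (hdim x0 hx0) => /h2 ->.
Qed.

End Embedding.

(** * Dimension of the frontier *)

Section Frontier.
Variable R : rcfType.
Implicit Types (rho : nat -> R) (A P : seq R -> Prop).

(** * Points as lists; [qdim] agrees with embeddings of cubes *)

Definition seq_set n (S : set 'rV[R]_n) (s : seq R) := S (\row_(i < n) s`_i).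

Definition seq_of_row n (x : 'rV[R]_n) := [seq x ord0 i | i <- enum 'I_n].

Lemma size_seq_of_row n (x : 'rV[R]_n) : size (seq_of_row x) = n.
Proof. by rewrite size_map size_enum_ord. Qed.

Lemma nth_seq_of_row n (x : 'rV[R]_n) (i : 'I_n) : (seq_of_row x)`_i = x ord0 i.
Proof. by rewrite (nth_map i) ?size_enum_ord// nth_ord_enum. Qed.

Lemma seq_of_rowK n (x : 'rV[R]_n) : \row_(i < n) (seq_of_row x)`_i = x.
Proof. by apply/rowP => i; rewrite mxE nth_seq_of_row. Qed.

Lemma row_inj n (s t : seq R) : size s = n -> size t = n ->
  \row_(i < n) s`_i = \row_(i < n) t`_i -> s = t.
Proof.
move=> hs ht /rowP st; apply: (@eq_from_nth _ 0); rewrite hs// => i hi.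
by have := st (Ordinal hi); rewrite !mxE.
Qed.

Lemma row_cat k n (s t : seq R) : size s = k ->
  \row_(i < k + n) (s ++ t)`_i = row_mx (\row_(i < k) s`_i) (\row_(i < n) t`_i).
Proof.
move=> hs; apply/rowP => i; rewrite !mxE nth_cat hs.
by case: splitP => j ->; rewrite mxE ?addKn.
Qed.

Lemma definable_seq_set n (S : set 'rV[R]_n) :
  semialgebraic S -> definable_on n (seq_set S).
Proof.
move=> /semialgebraic_definable hS; apply: (definable_iff hS) => rho.
by rewrite /seq_set row_mkseq.
Qed.

Lemma qdim_cube_embeds n k (S : set 'rV[R]_n) : semialgebraic S ->
  qdim n k (seq_set S) -> cube_embeds k S.
Proof.
move=> /definable_seq_set hS h.
have [Phi [szP dP /(_ (fun=> 0) h) [hPhi injPhi]]] := qdim_embed k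
  (P := fun=> seq_set S) hS.
have foldrE (s : seq R) : foldr (@scons R) (fun=> 0) s = nth 0 s.
  by apply/funext => i; elim: s i => [|x s IH] [|i] //=.
have cubeP (x : 'rV[R]_k) : open_cube x -> in_cube k (seq_of_row x).
  by move=> hx; split; [exact: size_seq_of_row|move=> t /mapP[i _ ->]; exact: hx].
pose phi (x : 'rV[R]_k) : 'rV[R]_n := \row_i (Phi (nth 0 (seq_of_row x)))`_i.
exists phi; split.
- apply: definable_semialgebraic.
  (* Variable 0 is the value, the next k are the cube coordinates, and the remaining ones get the
     constant parameter 0. *)
  pose sigma j i := if i is i'.+1 then
      fun rho : nat -> R => (mkseq rho k)`_i' else fun rho => rho (k + j)%N.
  have hsigma j i : polyfun (sigma j i).
    case: i => [|i]; first exact: polyfun_var.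
    by apply: (@polyfun_nth _ k (fun i rho => rho i)) => ?; exact: polyfun_var.
  have d1 : definable (fun rho => forall i : 'I_k, 0 < rho i /\ rho i < 1).
    by apply: definable_all_fin => i; apply: definable_and; apply: definable_lt;
      do ?[exact: polyfun_var|exact: polyfun_cst].
  have d2 : definable (fun rho => forall j : 'I_n,
      rho (k + j)%N = (Phi (nth 0 (mkseq rho k)))`_j).
    by apply: definable_all_fin => j; exact: (definable_subst (hsigma j) (dP j)).
  apply: (definable_iff (definable_and d1 d2)) => rho.
  have rowE : seq_of_row (\row_(i < k) rho i) = mkseq rho k.
    apply: (@eq_from_nth _ 0); rewrite size_seq_of_row ?size_mkseq// => i hi.
    by rewrite (nth_seq_of_row _ (Ordinal hi)) mxE nth_mkseq.
  split.
    move=> [h1 h2]; exists (\row_i rho i).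
      by move=> i; rewrite mxE; have [-> ->] := h1 i.
    apply/rowP => i; rewrite !mxE; case: splitP => j ->; rewrite !mxE//.
    by rewrite rowE.
  move=> [x hx hrho].
  have xE : x = \row_i rho i.
    apply/rowP => i; have /rowP/(_ (lshift n i)) := hrho.
    by rewrite row_mxEl !mxE.
  split=> [i|j].
    by have := hx i; rewrite xE mxE => /andP.
  have /rowP/(_ (rshift k j)) := hrho.
  by rewrite row_mxEr xE !mxE rowE => ->.
- move=> x y; rewrite !inE => hx hy /rowP hxy.
  have E : seq_of_row x = seq_of_row y.
    apply: injPhi; [exact: cubeP|exact: cubeP|].
    apply: (@eq_from_nth _ 0); rewrite ?szP// => i hi.
    by rewrite !foldrE; have := hxy (Ordinal hi); rewrite !mxE.
  by rewrite -(seq_of_rowK x) E seq_of_rowK.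
- move=> _ [x hx <-]; have := hPhi _ (cubeP x hx).
  by rewrite foldrE.
Qed.

Lemma definable_on_rot n m P : (m <= n)%N ->
  definable_on n P -> definable_on n (fun s => P (rot m s)).
Proof.
move=> mn; apply: (definable_on_reindex
  (g := fun i => if (i + m < n)%N then (i + m)%N else (i + m - n)%N)) => v.
apply: (@eq_from_nth _ 0); rewrite size_rot !size_mkseq// => i hi.
rewrite (nth_mkseq _ _ hi) /rot nth_cat size_drop size_mkseq.
case: ltnP => h.
  by rewrite nth_drop nth_mkseq ?ifT; [congr v; lia|lia|lia].
rewrite nth_take ?nth_mkseq ?ifF; [congr v; lia|lia|lia|].
by lia.
Qed.

(** The graph of the embedding inherits k from the cube. After a rotation the values come first and,
    by injectivity, determine the arguments, which are projected away. *)
Lemma cube_embeds_qdim n k (S : set 'rV[R]_n) :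
  cube_embeds k S -> qdim n k (seq_set S).
Proof.
move=> [phi [/definable_seq_set dG injphi hphi]].
have cubeP (s : seq R) : (forall j, (j < k)%N -> 0 < s`_j < 1) ->
    open_cube (\row_(i < k) s`_i).
  by move=> h i; rewrite mxE h.
have hG : qdim (k + n) k (seq_set (graph_on (@open_cube R k) phi)).
  apply: (@qdim_cat _ k n k (fun s => forall j, (j < k)%N -> 0 < s`_j < 1)).
    move=> s hs /cubeP hx; exists (seq_of_row (phi (\row_i s`_i))).
      exact: size_seq_of_row.
    by rewrite /seq_set row_cat// seq_of_rowK; eexists; [exact: hx|].
  apply: (@qdim_box _ k (fun _ x => 0 < x < 1)) => // j _.
  exact/infinite_itv/ltr01.
set G := seq_set (graph_on (@open_cube R k) phi) in dG hG.
have rot2 (s : seq R) : size s = (k + n)%N -> rot n (rot k s) = s.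
  move=> hs; rewrite -{1}(cat_take_drop k s).
  have h1 : size (take k s) = k by rewrite size_takel// hs leq_addr.
  have h2 : size (drop k s) = n by rewrite size_drop hs addKn.
  by rewrite -{1}h1 rot_size_cat -{1}h2 rot_size_cat cat_take_drop.
have nkn : (n <= k + n)%N by exact: leq_addl.
have {}hG : qdim (k + n) k (fun s => G (rot n s)).
  apply: (qdim_rot (definable_on_rot nkn dG) (leq_addr n k)).
  by apply: qdim_sub hG => s hs; rewrite rot2.
have GE x y : size x = k -> size y = n -> G (x ++ y) ->
    open_cube (\row_(i < k) x`_i) /\
    phi (\row_(i < k) x`_i) = \row_(i < n) y`_i.
  move=> hx hy; rewrite /G /seq_set row_cat// => -[a ha].
  by move=> /eq_row_mx[<- <-].
rewrite addnC in hG.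
apply: (qdim_sub _ (qdim_functional _ hG)) => [y hy|y u v hy hu hv].
  move=> [x hx]; rewrite -{1}hy rot_size_cat => /(GE _ _ hx hy)[hc hphix].
  by rewrite /seq_set -hphix; apply: hphi; eexists; [exact: hc|].
have rotE z : rot n (y ++ z) = z ++ y by rewrite -hy rot_size_cat.
rewrite !rotE => /(GE _ _ hu hy)[hcu eu] /(GE _ _ hv hy)[hcv ev].
apply: (row_inj hu hv); apply: injphi; rewrite ?inE//.
by rewrite eu ev.
Qed.

(** * Closures of fibers and the frontier inequality *)

Definition seq_closure n A s := forall d, 0 < d -> exists s',
  [/\ size s' = n, A s' & forall i, (i < n)%N -> `|s`_i - s'`_i| < d].

Lemma definable_seq_closure n A :
  definable_on n A -> definable_on n (seq_closure n A).
Proof.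
move=> dA.
have h : definable (fun rho => forall d, 0 < d -> exists2 s', size s' = n &
    A s' /\ forall i, (i < n)%N -> `|(mkseq rho n)`_i - s'`_i| < d).
  apply: (definable_forall (P := fun d rho => 0 < d -> exists2 s', size s' = n &
    A s' /\ forall i, (i < n)%N -> `|(mkseq rho n)`_i - s'`_i| < d)).
  apply: definable_imp; first exact: (definable_pos (polyfun_var _ 0%N)).
  apply: (definable_ex_seq (P := fun s' rho => A s' /\ forall i, (i < n)%N ->
    `|(mkseq (fun i => rho i.+1) n)`_i - s'`_i| < rho 0%N)).
  apply: definable_and => //; apply: definable_all_ltn => i.
  apply: definable_abs_lt; last exact: polyfun_var.
  apply: polyfunB.
    by apply: (@polyfun_nth _ _ (fun i rho => rho (n + i.+1)%N)) => ?;
      exact: polyfun_var.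
  by apply: (@polyfun_nth _ _ (fun i rho => rho i)) => ?; exact: polyfun_var.
apply: (definable_iff h) => rho; split=> H d /H.
  by move=> [s' h1 [h2 h3]]; exists s'.
by move=> [s' [h1 h2 h3]]; exists s'.
Qed.

(* The fibers of the closure are the closures of the fibers, except over
   finitely many points: otherwise a whole family of balls b, of center c and
   radius r, would witness the failure, and by exchange of quantifiers some ball
   would do it for all x in an interval I; but then I x b is an open set that
   meets the closure of A but not A. *)
Lemma finite_closure_fibers n A : definable_on n.+1 A ->
  ~ infinite (fun x => exists s, [/\ size s = n, seq_closure n.+1 A (x :: s) &
    ~ seq_closure n (fun s => A (x :: s)) s]).
Proof.
move=> dA hinf.
pose near (s b : seq R) e := forall j, (j < n)%N -> `|s`_j - b`_j.+1| < e.
(* Here b codes a radius (entry 0), a center (entries 1 to n) and the point x (entry n + 1). The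
   inner radius e leaves room to approximate s within the ball. *)
pose P (b : seq R) :=
  ~ (exists2 s, size s = n & near s b b`_0 /\ A (b`_n.+1 :: s)) /\
  exists2 s, size s = n & seq_closure n.+1 A (b`_n.+1 :: s) /\
    exists e, e < b`_0 /\ near s b e.
have dP : definable_on n.+2 P.
  have pv m i : polyfun (fun rho : nat -> R => (mkseq (fun i => rho (m + i)%N) n.+2)`_i).
    by apply: (@polyfun_nth _ _ (fun i rho => rho (m + i)%N)) => ?;
      exact: polyfun_var.
  have pv0 m i : polyfun (fun rho : nat -> R =>
      (mkseq (fun i => rho (m + i)%N) n)`_i).
    by apply: (@polyfun_nth _ _ (fun i rho => rho (m + i)%N)) => ?;
      exact: polyfun_var.
  have dAx A' : definable_on n.+1 A' -> definable (fun rho =>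
      A' ((mkseq (fun i => rho (n + i)%N) n.+2)`_n.+1 :: mkseq rho n)).
    move=> dA'; pose sigma i := if i is j.+1 then fun rho : nat -> R => rho j
      else fun rho => (mkseq (fun i => rho (n + i)%N) n.+2)`_n.+1.
    have hs i : polyfun (sigma i) by case: i => [|i]; [exact: pv|exact: polyfun_var].
    by apply: (definable_iff (definable_subst hs dA')) => rho; rewrite mkseq_cons.
  apply: definable_and.
    apply: definable_not; apply: (definable_ex_seq (P := fun s rho =>
      near s (mkseq rho n.+2) (mkseq rho n.+2)`_0 /\
      A ((mkseq rho n.+2)`_n.+1 :: s))).
    apply: definable_and; last exact: dAx.
    apply: definable_all_ltn => j; apply: definable_abs_lt; last exact: pv.
    by apply: polyfunB; [exact: (pv0 0%N)|exact: pv].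
  apply: (definable_ex_seq (P := fun s rho =>
      seq_closure n.+1 A ((mkseq rho n.+2)`_n.+1 :: s) /\
      exists e, e < (mkseq rho n.+2)`_0 /\ near s (mkseq rho n.+2) e)).
  apply: definable_and; first exact/dAx/definable_seq_closure.
  apply: (definable_ex (P := fun e rho =>
    e < (mkseq (fun i => rho (n + i)%N) n.+2)`_0 /\
    near (mkseq rho n) (mkseq (fun i => rho (n + i)%N) n.+2) e)).
  have pv1 i : polyfun (fun rho : nat -> R =>
      (mkseq (fun i => rho (n + i).+1) n.+2)`_i).
    by apply: (@polyfun_nth _ _ (fun i rho => rho (n + i).+1)) => ?;
      exact: polyfun_var.
  apply: definable_and; first by apply: definable_lt => //; exact: polyfun_var.
  apply: definable_all_ltn => j; apply: definable_abs_lt; last exact: polyfun_var.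
  by apply: polyfunB; [exact: (pv0 1%N)|exact: pv1].
have : qdim n.+2 n.+2 (fun t => P (insert_at n.+1 t)).
  right; apply: infinite_sub hinf => x [s [hs clx nclx]].
  have /existsNP[d /not_implyP[d0 hd]] := nclx.
  (* The ball contains s because |s - c| < d/4 < r, and it stays within d of s because r + d/4 <
     d. *)
  pose I j := if j is j'.+1 then fun c => s`_j' - d / 4 < c < s`_j' + d / 4
    else fun r => d / 4 < r < d / 2.
  apply: (qdim_box (I := I)) => [[|j] _|b hb Ib].
  - by apply: infinite_itv; lra.
  - by apply: infinite_itv; lra.
  have -> : insert_at n.+1 (x :: b) = rcons b x.
    by rewrite /= take_oversize ?drop_oversize ?hb// cats1.
  have bx j : (j < n.+1)%N -> (rcons b x)`_j = b`_j by move=> ?; rewrite nth_rcons hb ifT.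
  have bn : (rcons b x)`_n.+1 = x by rewrite nth_rcons hb ltnn eqxx.
  have b0 := Ib 0%N isT; split; rewrite bn bx//.
    move=> [s' hs' [near_s' As']]; apply: hd; exists s'; split=> // j hj.
    have := near_s' j hj; rewrite bx//; have := Ib j.+1 hj; move: b0 => /=.
    move=> /andP[? ?] /andP[? ?]; rewrite !ltr_norml => /andP[? ?].
    by apply/andP; split; lra.
  exists s => //; split=> //; exists (d / 4); split; first by case/andP: b0.
  move=> j hj; rewrite bx//; have /= /andP[? ?] := Ib j.+1 hj.
  by rewrite ltr_norml; apply/andP; split; lra.
(* Once x is quantified last, the full count yields a single ball that works for infinitely many
   x. *)
move=> /(qdim_insert_at dP (leqnn _))/qdim_full[b hb hinfb].
pose sigma i := if i == n.+1 then fun rho : nat -> R => rho 0%N else fun=> b`_i.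
have hsigma i : polyfun (sigma i).
  by rewrite /sigma; case: ifP => _; [exact: polyfun_var|exact: polyfun_cst].
have dPb : definable (fun rho => P (rcons b (rho 0%N))).
  apply: (definable_iff (definable_subst hsigma dP)) => rho.
  suff -> : mkseq (fun i => sigma i rho) n.+2 = rcons b (rho 0%N) by [].
  apply: (@eq_from_nth _ 0); rewrite size_mkseq ?size_rcons ?hb// => i hi.
  rewrite nth_mkseq// nth_rcons hb /sigma.
  case: ltnP => [hi'|hi']; first by rewrite ltn_eqF.
  have -> : i = n.+1 by lia.
  by rewrite eqxx.
have [x1 [x2 [x12 hx]]] := infinite_interval (rho := fun=> 0) dPb hinfb.
have bx y j : (j < n.+1)%N -> (rcons b y)`_j = b`_j by move=> ?; rewrite nth_rcons hb ifT.
have bn y : (rcons b y)`_n.+1 = y by rewrite nth_rcons hb ltnn eqxx.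
have [|_] := hx ((x1 + x2) / 2); first by apply/andP; split; lra.
rewrite /= bn bx// => -[s hs [cls [e [er near_s]]]].
(* A point of A this close to (x, s) has its first coordinate in the interval and the others in the
   ball, against the choice of the ball. *)
have [|[|x' s'] [// hs' As' near']] := cls (Num.min (b`_0 - e) ((x2 - x1) / 2)).
  by rewrite lt_min !subr_gt0 er/= divr_gt0// subr_gt0.
have := near' 0%N isT; rewrite lt_min /= !ltr_norml => /andP[_ /andP[xx1 xx2]].
have [|hx' _] := hx x'; first by apply/andP; split; lra.
apply: hx'; rewrite /= bn bx//; exists s'; first by case: hs'.
split=> // j hj; have := near' j.+1 hj; rewrite lt_min => /andP[/= h1 _].
have := near_s j hj; rewrite !bx// in h1 *.
move: h1; rewrite !ltr_norml => /andP[? ?] /andP[? ?].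
by apply/andP; split; lra.
Qed.

(** Some coordinate of the frontier carries an infinite quantifier. For all but finitely many of its
    values the fiber of the closure lies in the closure of the fiber, so induction applies to the
    fibers, and the quantifier on that coordinate contributes the remaining 1. *)
Lemma qdim_frontier n k A : definable_on n A ->
  qdim n k (fun s => seq_closure n A s /\ ~ A s) -> qdim n k.+1 A.
Proof.
have nth_insert_at i j x (s : seq R) : (i <= size s)%N ->
    (insert_at i (x :: s))`_j =
    if (j < i)%N then s`_j else if j == i then x else s`_j.-1.
  move=> hi; rewrite /= nth_cat size_takel//.
  case: ltnP => hji; first by rewrite nth_take.
  case: eqVneq => [->|ji]; first by rewrite subnn.
  have -> : (j - i = (j - i).-1.+1)%N by lia.
  by rewrite /= nth_drop; congr nth; lia.
(* The first infinite quantifier can be moved to the front: the plain ones before it keep their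
   witnesses. *)
have pull m j P : qdim m.+1 j.+1 P -> exists2 i, (i <= m)%N &
    infinite (fun x => qdim m j (fun s => P (insert_at i (x :: s)))).
  elim: m P => [|m IH] P /qdimSS[[t]|h].
  - by case.
  - exists 0%N => //; apply: infinite_sub h => x.

  - move=> /IH[i im h]; exists i.+1 => //; apply: infinite_sub h => x h.
    by left; exists t.
  - by exists 0%N => //; apply: infinite_sub h => x; apply: qdim_sub => -[].
elim: n k A => [|n IH] k A dA.
  by move=> [_ [/(_ 1 ltr01)[s [/size0nil -> ? _]]]].
case: k => [|k].
  (* A finite set is closed, so a frontier point forces A to be infinite. *)
  move=> /qdim_nonempty[s hs [cls nAs]]; apply: contrapT => /qdim_finite[L hL].
  suff [d d0 hd] : exists2 d, 0 < d & forall s', s' \in L -> size s' = n.+1 ->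
      A s' -> exists2 i, (i < n.+1)%N & d <= `|s`_i - s'`_i|.
    have [s' [hs' As' near']] := cls d d0.
    have [i hi] := hd s' (hL s' hs' As') hs' As'.
    by rewrite leNgt near'.
  elim: L {hL} => [|s' L [d d0 hd]]; first by exists 1.
  have [->|ns'] := eqVneq s' s.
    by exists d => // s''; rewrite inE => /predU1P[->|]//; exact: hd.
  have [hs'|hs'] := EM (size s' = n.+1); last first.
    by exists d => // s''; rewrite inE => /predU1P[->|]//; exact: hd.
  have [i hi nei] : exists2 i, (i < n.+1)%N & s`_i != s'`_i.
    apply: contrapT => h; move/eqP: ns'; apply; apply: (@eq_from_nth _ 0).
      by rewrite hs hs'.
    rewrite hs' => i hi; apply/esym/eqP; apply: contrapT => /negP nei.
    by apply: h; exists i.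
  exists (Num.min d `|s`_i - s'`_i|).
    by rewrite lt_min d0 normr_gt0 subr_eq0.
  move=> s''; rewrite inE => /predU1P[->|h] h1 h2.
    by exists i => //; rewrite ge_min lexx orbT.
  have [i' hi' hle] := hd s'' h h1 h2.
  by exists i' => //; rewrite ge_min hle.
move=> /pull[i hin hinf].
have dAi := definable_on_insert_at hin dA.
apply: (qdim_insert_at dA hin).
right; have fin := finite_closure_fibers dAi.
suff /infinite_or[//|h] : infinite (fun x =>
    (exists s, [/\ size s = n,
      seq_closure n.+1 (fun s => A (insert_at i s)) (x :: s) &
      ~ seq_closure n (fun s => A (insert_at i (x :: s))) s]) \/
    qdim n k (fun s => seq_closure n (fun s => A (insert_at i (x :: s))) s /\
      ~ A (insert_at i (x :: s)))).
  apply: infinite_sub h => x.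
  exact: (IH k (fun s => A (insert_at i (x :: s))) (definable_on_cons x dAi)).
apply: infinite_sub hinf => x hx.
have [h|h] := EM (exists s, [/\ size s = n,
      seq_closure n.+1 (fun s => A (insert_at i s)) (x :: s) &
      ~ seq_closure n (fun s => A (insert_at i (x :: s))) s]); first by left.
right; apply: qdim_sub hx => s hs [cls nA]; split=> //.
apply: contrapT => ncl; apply: h; exists s; split=> // d d0.
have [s' [hs' As' near']] := cls d d0.
have is' : (i < size s')%N by rewrite hs'.
(* Coordinate i of the approximating point is brought to the front, to undo [insert_at]. *)
exists (s'`_i :: take i s' ++ drop i.+1 s'); split.
- by rewrite /= size_cat size_takel ?size_drop ?hs'; lia.
- rewrite [insert_at _ _]/= take_size_cat ?size_takel ?(ltnW is')//.
  rewrite drop_size_cat ?size_takel ?(ltnW is')//.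
  by rewrite -drop_nth// cat_take_drop.
move=> [_|j hj].
  have := near' i hin; rewrite nth_insert_at ?hs//.
  by rewrite ltnn eqxx.
rewrite /= nth_cat size_takel ?(ltnW is')//; case: ltnP => hji.
  have := near' j (ltnW hj); rewrite nth_insert_at ?hs// hji.
  by rewrite nth_take.
have := near' j.+1 hj; rewrite nth_insert_at ?hs// ltnNge (leqW hji)/=.
rewrite gtn_eqF// nth_drop.
by have -> : (i.+1 + (j - i) = j.+1)%N by lia.
Qed.

End Frontier.

(** * Boxes as neighborhoods; existence of dimensions and local dimensions *)

Section Box.
Variables (R : rcfType) (n : nat).
Implicit Types (q x : 'rV[R]_n) (S U W : set 'rV[R]_n).

Definition box q (d : R) : set 'rV[R]_n :=
  [set x | forall i, `|q ord0 i - x ord0 i| < d].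

Lemma box_trans q x y d e : box q d x -> box x e y -> box q (d + e) y.
Proof.
move=> h1 h2 i; have := h1 i; have := h2 i; rewrite !ltr_norml.
by move=> /andP[? ?] /andP[? ?]; apply/andP; split; lra.
Qed.

Lemma box_le q d e : d <= e -> box q d `<=` box q e.
Proof. by move=> de x h i; apply: lt_le_trans (h i) de. Qed.

Lemma nbhs_box q U : nbhs q U <-> exists2 d, 0 < d & box q d `<=` U.
Proof.
apply: (iff_trans (nbhs_ballP q U)).
split=> -[d /= d0 h]; exists d => //= x hx; apply: h.
  by split=> // i j; rewrite ord1 -ball_normE; exact: hx.
by move=> i; have := hx.2 ord0 i; rewrite -ball_normE.
Qed.

Lemma closure_box S q :
  closure S q <-> forall d, 0 < d -> exists x, S x /\ box q d x.
Proof.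
split=> [h d d0|h U /nbhs_box[d d0 dU]].
  by apply: h; apply/nbhs_box; exists d.
by have [x [Sx /dU]] := h d d0; exists x.
Qed.

Lemma definable_box (sigma tau : nat -> (nat -> R) -> R) (d : (nat -> R) -> R) :
  (forall i, polyfun (sigma i)) -> (forall i, polyfun (tau i)) -> polyfun d ->
  definable (fun rho =>
    box (\row_i sigma i rho) (d rho) (\row_i tau i rho)).
Proof.
move=> hs ht hd; apply: definable_all_fin => i; apply: definable_abs_lt => //.
by apply: polyfunB; exact: polyfun_row.
Qed.

Lemma semialgebraic_setI S U :
  semialgebraic S -> semialgebraic U -> semialgebraic (S `&` U).
Proof.
move=> hS hU; rewrite -(setCK (S `&` U)) setCI.
by do ?[apply: semialgebraic_setC|apply: semialgebraic_setU].
Qed.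

Lemma semialgebraic_setT : semialgebraic [set: 'rV[R]_n].
Proof. by apply: definable_semialgebraic; exact: definable_const. Qed.

(** A largest k exists because [qdim_leq] bounds every k by n. *)
Lemma is_dim_ex S : semialgebraic S -> S !=set0 -> exists k : nat, is_dim S k%:Z.
Proof.
move=> saS [x Sx].
have ex0 : exists k, `[< cube_embeds k S >].
  exists 0%N; apply/asboolP/qdim_cube_embeds => //.
  by apply: (qdim0 (size_seq_of_row x)); rewrite /seq_set seq_of_rowK.
have bnd k : `[< cube_embeds k S >] -> (k <= n)%N.
  by move=> /asboolP/cube_embeds_qdim/qdim_leq.
case: (ex_maxnP ex0 bnd) => k /asboolP hk max_k; exists k; split.
  by right; exists k.
by move=> j hj; rewrite lez_nat; apply: max_k; apply/asboolP.
Qed.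

Lemma is_local_dim_ex S q : semialgebraic S -> closure S q ->
  exists k : nat, is_local_dim S q k%:Z.
Proof.
move=> saS cl.
have ne W : open_semialgebraic_nbhd q W -> exists k : nat, is_dim (S `&` W) k%:Z.
  move=> [oW saW Wq]; apply: is_dim_ex; first exact: semialgebraic_setI.
  exact/cl/open_nbhs_nbhs.
pose p k := `[< exists2 W, open_semialgebraic_nbhd q W & is_dim (S `&` W) k%:Z >].
have exp : exists k, p k.
  have hT : open_semialgebraic_nbhd q setT.
    by split; [exact: openT|exact: semialgebraic_setT|].
  by have [k hk] := ne _ hT; exists k; apply/asboolP; exists setT.
case: (ex_minnP exp) => k /asboolP[W hW hk] min_k; exists k; split.
  by exists W.
move=> W' e hW' he; have [j hj] := ne _ hW'.
have -> : e = j%:Z.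
  have eq_dim a b : is_dim (S `&` W') a -> is_dim (S `&` W') b -> 0 <= b -> a <= b.
    by move=> [[[_ ->]|[i -> hi]] _] [_ hb] b0; [exact: le_trans b0|exact: hb].
  have e0 : 0 <= e.
    case: (he) => [[[S0 _]|[i -> _]] _] //.
    case: (hj) => [[[_ //]|[i _ /cube_embeds_qdim/qdim_nonempty[s _ Ps]]] _].
    by move: Ps; rewrite /seq_set S0.
  by apply/le_anti/andP; split; apply: (eq_dim _ _).
by rewrite lez_nat; apply: min_k; apply/asboolP; exists W'.
Qed.

End Box.

(** * Extension to the non-oscillating points *)

Section Extension.
Variables (R : rcfType) (n : nat) (M : set 'rV[R]_n) (f : 'rV[R]_n -> R).
Hypotheses (saM : semialgebraic M) (hf : semialgebraic_function M f).
Implicit Types (q x : 'rV[R]_n) (B : R -> Prop).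

(** Off M the values of f are arbitrary, so only the conjunction is definable. This is why
    [frequently] quantifies over the value u. *)
Lemma definable_value (sigma : nat -> (nat -> R) -> R) (u : (nat -> R) -> R) :
  (forall i, polyfun (sigma i)) -> polyfun u ->
  definable (fun rho => M (\row_(i < n) sigma i rho) /\
    f (\row_(i < n) sigma i rho) = u rho).
Proof.
move=> hs hu; case: hf => _ /definable_mem.
move=> /(_ (fun i => if (i < n)%N then sigma i else u)) h.
have {}h := h (fun i => if (i < n)%N as b return polyfun (if b then _ else _)
  then hs i else hu).
apply: (definable_iff h) => rho.
have -> : \row_(i < n + 1) (if (i < n)%N then sigma i else u) rho =
    row_mx (\row_(i < n) sigma i rho) (const_mx (u rho)).
  by apply/rowP => i; rewrite !mxE; case: splitP => j ij; rewrite mxE ?ij.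
split=> [[x Mx /eq_row_mx[<- /rowP/(_ ord0)]]|[Mx <-]]; first by rewrite !mxE.
by eexists; [exact: Mx|].
Qed.

(* f takes values in B at points of M arbitrarily close to q. *)
Definition frequently q B := forall d, 0 < d ->
  exists x, box q d x /\ exists u, (M x /\ f x = u) /\ B u.

Lemma definable_frequently (sigma : nat -> (nat -> R) -> R)
    (B : R -> (nat -> R) -> Prop) :
  (forall i, polyfun (sigma i)) ->
  definable (fun rho => B (rho 0%N) (fun i => rho i.+1)) ->
  definable (fun rho => frequently (\row_(i < n) sigma i rho) (B^~ rho)).
Proof.
move=> hs hB.
apply: (definable_forall (P := fun d rho => 0 < d -> exists x,
  box (\row_(i < n) sigma i rho) d x /\ exists u, (M x /\ f x = u) /\ B u rho)).
apply: definable_imp; first exact: (definable_pos (polyfun_var _ 0%N)).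
apply: (definable_ex_row (P := fun x rho =>
  box (\row_(i < n) sigma i (fun i => rho i.+1)) (rho 0%N) x /\
  exists u, (M x /\ f x = u) /\ B u (fun i => rho i.+1))).
apply: definable_and.
  apply: (@definable_box _ _ (fun i rho => sigma i (fun j => rho (n + j.+1)%N))
    (fun i rho => rho i) (fun rho => rho (n + 0)%N)) => [i|i|];
    do ?exact: polyfun_var.
  by apply: (@polyfun_subst _ _ (fun j rho => rho (n + j.+1)%N)) => // j;
    exact: polyfun_var.
apply: (definable_ex (P := fun u rho =>
  (M (\row_(i < n) rho i) /\ f (\row_(i < n) rho i) = u) /\
  B u (fun i => rho (n + i.+1)%N))).
apply: definable_and.
  by apply: (@definable_value (fun i rho => rho i.+1) (fun rho => rho 0%N)) => [?|];
    exact: polyfun_var.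
exact: (definable_rename (fun i => if i is j.+1 then (n + j.+1).+1 else 0%N) hB).
Qed.

Lemma frequentlyP q B : frequently q B <->
  forall d, 0 < d -> exists x, [/\ box q d x, M x & B (f x)].
Proof.
split=> h d d0; have [x] := h d d0; first by move=> [? [u [[? <-] ?]]]; exists x.
by move=> [? ? ?]; exists x; split=> //; exists (f x).
Qed.

Lemma not_frequently q B : ~ frequently q B ->
  exists2 d, 0 < d & forall x, box q d x -> M x -> ~ B (f x).
Proof.
move=> /existsNP[d /not_implyP[d0 h]]; exists d => // x qx Mx Bx.
by apply: h; exists x; split=> //; exists (f x).
Qed.

Lemma continuous_box q e : M q -> 0 < e ->
  exists2 d, 0 < d & forall x, box q d x -> M x -> `|f x - f q| < e.
Proof.
move=> Mq e0; case: hf => /subspace_continuousP/(_ q Mq) hc _.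
have /cvgrPdist_lt/(_ e e0) := hc.
rewrite near_withinE near_simpl => /nbhs_box[d d0 hd]; exists d => // x qx Mx.
by rewrite distrC; exact: hd.
Qed.

Definition bounded_near q := exists N, ~ frequently q (fun u => N < u \/ N < - u).

(** The set V. Its first condition is membership in Cl(M), by [closureE], in a form covered by
    [definable_frequently]. *)
Definition bounded_locus := [set q | frequently q (fun=> True) /\ bounded_near q].

Definition oscillation_locus := [set q | [/\ bounded_locus q, ~ M q &
  exists a b, [/\ a < b, frequently q (fun u => b < u) & frequently q (fun u => u < a)]]].

Lemma closureE q : closure M q <-> frequently q (fun=> True).
Proof.
rewrite closure_box; split=> h d d0; have [x] := h d d0.
  by move=> [Mx qx]; exists x; split=> //; exists (f x).
by move=> [qx [u [[Mx _] _]]]; exists x.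
Qed.

Lemma semialgebraic_bounded_locus : semialgebraic bounded_locus.
Proof.
apply: definable_semialgebraic; apply: definable_and.
  apply: (@definable_frequently (fun i rho => rho i) (fun _ _ => True)) => [i|].
    exact: polyfun_var.
  exact: definable_const.
apply: (definable_ex (P := fun N rho =>
  ~ frequently (\row_i rho i) (fun u => N < u \/ N < - u))).
apply: definable_not.
apply: (@definable_frequently (fun i rho => rho i.+1)
  (fun u rho => rho 0%N < u \/ rho 0%N < - u)) => [i|]; first exact: polyfun_var.
by apply: definable_or; apply: definable_lt; do ?apply: polyfunN;
  exact: polyfun_var.
Qed.

Lemma semialgebraic_oscillation_locus : semialgebraic oscillation_locus.
Proof.
have d1 := semialgebraic_definable semialgebraic_bounded_locus.
have d2 := definable_not (semialgebraic_definable saM).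
have d3 : definable (fun rho => exists a, exists b, a < b /\
    (frequently (\row_i rho i) (fun u => b < u) /\ frequently (\row_i rho i) (fun u => u < a))).
  apply: (definable_ex (P := fun a rho => exists b, a < b /\
    (frequently (\row_i rho i) (fun u => b < u) /\ frequently (\row_i rho i) (fun u => u < a)))).
  apply: (definable_ex (P := fun b rho => rho 0%N < b /\
    (frequently (\row_i rho i.+1) (fun u => b < u) /\
     frequently (\row_i rho i.+1) (fun u => u < rho 0%N)))).
  apply: definable_and; first by apply: definable_lt; exact: polyfun_var.
  apply: definable_and.
    apply: (@definable_frequently (fun i rho => rho i.+2)
      (fun u rho => rho 0%N < u)) => [i|]; first exact: polyfun_var.
    by apply: definable_lt; exact: polyfun_var.
  apply: (@definable_frequently (fun i rho => rho i.+2)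
    (fun u rho => u < rho 1%N)) => [i|]; first exact: polyfun_var.
  by apply: definable_lt; exact: polyfun_var.
apply: definable_semialgebraic.
apply: (definable_iff (definable_and d1 (definable_and d2 d3))) => rho; split.
  by move=> [h1 [h2 [a [b [h3 [h4 h5]]]]]]; split=> //; exists a, b.
by move=> [h1 h2 [a [b [h3 h4 h5]]]]; split=> //; split=> //; exists a, b.
Qed.

Lemma open_bounded_near : open [set q | bounded_near q].
Proof.
rewrite openE => q [N /not_frequently[d d0 hd]]; apply/nbhs_box.
exists (d / 2); first by rewrite divr_gt0.
move=> x qx; exists N => /frequentlyP /(_ (d / 2)).
rewrite divr_gt0// => /(_ isT)[y [xy My]]; apply: hd => //.
by have := box_trans qx xy; rewrite -splitr.
Qed.

Lemma sub_bounded_locus : M `<=` bounded_locus.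
Proof.
move=> q Mq; split; first by apply/closureE; exact: subset_closure.
have [d d0 hd] := continuous_box Mq ltr01.
exists (`|f q| + 1) => /frequentlyP/(_ d d0)[x [qx Mx]].
have := hd x qx Mx; rewrite ltr_norml => /andP[h1 h2].
have := ler_norm (f q); have := ler_norm (- f q); rewrite normrN.
by move=> h3 h4 [h|h]; lra.
Qed.

Definition has_limit q c := forall e, 0 < e ->
  exists2 d, 0 < d & forall x, box q d x -> M x -> `|f x - c| <= e.

(** Outside M the limit is the upper limit of f at q, a supremum provided by [definable_sup]; values
    frequently well below it would make q an oscillation point. *)
Lemma bounded_has_limit q : (bounded_locus `\` oscillation_locus) q ->
  exists c, has_limit q c /\ (M q -> c = f q).
Proof.
move=> [[clq [N hN]] nY]; have [Mq|nMq] := EM (M q).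
  exists (f q); split=> // e e0; have [d d0 hd] := continuous_box Mq e0.
  by exists d => // x qx Mx; apply/ltW/hd.
have [d0 d00 hd0] := not_frequently hN.
have dS : definable (fun rho => frequently q (fun u => rho 0%N < u)).
  have := @definable_frequently (fun i => fun=> (seq_of_row q)`_i)
    (fun u rho => rho 0%N < u) (fun i => polyfun_cst _)
    (definable_lt (polyfun_var _ 1%N) (polyfun_var _ 0%N)).
  by move/definable_iff; apply=> rho; rewrite seq_of_rowK.
(* Near q the values of f on M lie in [-N, N]; the 1 makes the lower bound strict. *)
have [||s t st|c [hc1 hc2]] := @definable_sup _ _ (fun=> 0) (- N - 1) N dS.
- apply/frequentlyP => d dp; have dm : 0 < Num.min d d0 by rewrite lt_min dp.
  have [x [qx [u [[Mx _] _]]]] := clq _ dm; exists x; split=> //.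
    by apply: box_le qx; rewrite ge_min lexx.
  have qx' : box q d0 x by apply: box_le qx; rewrite ge_min lexx orbT.
  by have /not_orP[_ /negP] := hd0 x qx' Mx; rewrite -leNgt /=; lra.
- move=> /frequentlyP/(_ d0 d00)[x [qx Mx /= h]].
  by apply: (hd0 x qx Mx); left.
- move=> /frequentlyP h; apply/frequentlyP => d dp.
  have [x [qx Mx /= h']] := h d dp; exists x; split=> //.
  exact: le_lt_trans st h'.
exists c; split=> // e e0.
have /not_frequently[d1 d10 hd1] : ~ frequently q (fun u => c + e < u).
  by apply: hc2; rewrite ltrDl.
have fr : frequently q (fun u => c - e / 2 < u) by apply: hc1; rewrite gtrBl divr_gt0.
have /not_frequently[d2 d20 hd2] : ~ frequently q (fun u => u < c - e).
  move=> fr'; apply: nY; split=> //; first by split=> //; exists N.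
  by exists (c - e), (c - e / 2); split=> //; lra.
exists (Num.min d1 d2); first by rewrite lt_min d10.
move=> x qx Mx.
have /negP : ~ c + e < f x.
  by apply: hd1 => //; apply: box_le qx; rewrite ge_min lexx.
have /negP : ~ f x < c - e.
  by apply: hd2 => //; apply: box_le qx; rewrite ge_min lexx orbT.
by rewrite -!leNgt ler_norml => h1 h2; apply/andP; split; lra.
Qed.

(** Pointwise limits vary continuously: for q' near q, both F q and F q' are close to f at a common
    point of M. *)
Lemma continuous_extension : exists F : 'rV[R]_n -> R,
  {within bounded_locus `\` oscillation_locus, continuous F} /\
  {in M, F =1 f}.
Proof.
have [F hF] : exists F : 'rV[R]_n -> R, forall q,
    (bounded_locus `\` oscillation_locus) q ->
    has_limit q (F q) /\ (M q -> F q = f q).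
  suff /choice[F hF] : forall q, exists c,
      (bounded_locus `\` oscillation_locus) q ->
      has_limit q c /\ (M q -> c = f q) by exists F.
  move=> q.
  have [/bounded_has_limit[c hc]|h] := EM ((bounded_locus `\` oscillation_locus) q).
    by exists c.
  by exists 0.
exists F; split; last first.
  move=> q /set_mem Mq; apply: (hF q _).2 => //; split; first exact: sub_bounded_locus.
  by case.
apply/subspace_continuousP => q hq; apply/cvgrPdist_lt => e e0.
have e3 : 0 < e / 3 by rewrite divr_gt0.
have [d d0 hd] := (hF q hq).1 _ e3.
rewrite near_withinE near_simpl; apply/nbhs_box.
exists (d / 2) => [|q' qq' hq']; first by rewrite divr_gt0.
have [d' d'0 hd'] := (hF q' hq').1 _ e3.
have [[clq' _] _] := hq'.
(* A point x this close to q' is within d' of q' and, through q', within d of q. *)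
have dm : 0 < Num.min d' (d / 2) by rewrite lt_min d'0 divr_gt0.
have [x [qx [u [[Mx _] _]]]] := clq' _ dm.
have h1 : `|f x - F q'| <= e / 3.
  by apply: hd' => //; apply: box_le qx; rewrite ge_min lexx.
have h2 : `|f x - F q| <= e / 3.
  apply: hd => //; rewrite [d]splitr; apply: box_trans qq' _.
  by apply: box_le qx; rewrite ge_min lexx orbT.
rewrite /from_subspace; move: h1 h2; rewrite !ler_norml ltr_norml.
by move=> /andP[? ?] /andP[? ?]; apply/andP; split; lra.
Qed.

(** * Intermediate values and the dimension of Y *)

Lemma semialgebraic_level (W : set 'rV[R]_n) B : semialgebraic W ->
  definable (fun rho => B (rho 0%N)) -> semialgebraic (M `&` W `&` [set x | B (f x)]).
Proof.
move=> saW dB; apply: definable_semialgebraic.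
have h : definable (fun rho => W (\row_(i < n) rho i) /\ exists u,
    (M (\row_(i < n) rho i) /\ f (\row_(i < n) rho i) = u) /\ B u).
  apply: definable_and; first exact: semialgebraic_definable.
  apply: (definable_ex (P := fun u rho =>
    (M (\row_(i < n) rho i) /\ f (\row_(i < n) rho i) = u) /\ B u)).
  apply: definable_and => //.
  by apply: (@definable_value (fun i rho => rho i.+1) (fun rho => rho 0%N)) => [?|];
    exact: polyfun_var.
apply: (definable_iff h) => rho; split.
  by move=> [Wx [u [[Mx <-] Bu]]].
by move=> [[Mx Wx] Bx]; split=> //; exists (f (\row_i rho i)).
Qed.

(** If f missed v, the sets f < v and f > v would be complementary and both closed, which
    connectedness forbids. *)
Lemma connected_value (W : set 'rV[R]_n) x y v : semialgebraic W ->
  semialgebraically_connected (M `&` W) -> (M `&` W) x -> (M `&` W) y ->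
  f x < v -> v < f y -> exists2 z, (M `&` W) z & f z = v.
Proof.
move=> saW conW hx hy fx fy; apply: contrapT => nov.
have neqv z : (M `&` W) z -> f z != v.
  by move=> hz; apply/eqP => fz; apply: nov; exists z.
have clin (B : R -> Prop) : (forall u, u != v -> ~ B u -> exists2 e, 0 < e &
      forall w, `|w - u| < e -> ~ B w) ->
    closed_in (M `&` W) (M `&` W `&` [set z | B (f z)]).
  move=> hB; exists (closure (M `&` W `&` [set z | B (f z)])).
    exact: closed_closure.
  apply/seteqP; split=> z [hz]; first by move=> Bz; split=> //; apply: subset_closure.
  move=> /closure_box cl; split=> //=; apply: contrapT => nB.
  have [e e0 he] := hB _ (neqv z hz) nB.
  have [d d0 hd] := continuous_box hz.1 e0.
  have [w [[[Mw _] Bw] zw]] := cl d d0.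
  exact: he (hd w zw Mw) Bw.
have clL : closed_in (M `&` W) (M `&` W `&` [set z | f z < v]).
  apply: (clin (fun u => u < v)) => u uv /negP; rewrite -leNgt => vu.
  exists (u - v); first by rewrite subr_gt0 lt_neqAle eq_sym uv.
  move=> w; rewrite ltr_norml /= => /andP[? ?] ?. lra.
have clR : closed_in (M `&` W) (M `&` W `&` [set z | v < f z]).
  apply: (clin (fun u => v < u)) => u uv /negP; rewrite -leNgt => vu.
  exists (v - u); first by rewrite subr_gt0 lt_neqAle uv.
  move=> w; rewrite ltr_norml /= => /andP[? ?] ?. lra.
have saL : semialgebraic (M `&` W `&` [set z | f z < v]).
  apply: (semialgebraic_level (B := fun u => u < v)) => //.
  by apply: definable_lt; [exact: polyfun_var|exact: polyfun_cst].
have saR : semialgebraic (M `&` W `&` [set z | v < f z]).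
  apply: (semialgebraic_level (B := fun u => v < u)) => //.
  by apply: definable_lt; [exact: polyfun_cst|exact: polyfun_var].
case: (conW _ _ saL saR clL clR).
- apply/seteqP; split=> // z [[_ /= h1] [_ /= h2]].
  by have := lt_trans h1 h2; rewrite ltxx.
- apply/seteqP; split=> [z [[]|[]]//|z hz].
  by have := neqv z hz; rewrite neq_lt => /orP[?|?]; [left|right].
- move=> E; have : (M `&` W `&` [set z | f z < v]) y by rewrite E.
  by move=> [_ /= h]; have := lt_trans h fy; rewrite ltxx.
- move=> E; have : (M `&` W `&` [set z | v < f z]) x by rewrite E.
  by move=> [_ /= h]; have := lt_trans h fx; rewrite ltxx.
Qed.

Hypothesis hconn : forall q, closure M q -> germ_connected M q.

(* Over the oscillation locus Y, the frontier of the graph of f contains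
   vertical segments, so dim Y + 1 < dim (graph of f) = dim M. *)
Lemma cube_embeds_oscillation_locus k (W : set 'rV[R]_n) :
  open W -> semialgebraic W ->
  cube_embeds k (oscillation_locus `&` W) -> cube_embeds k.+2 (M `&` W).
Proof.
move=> oW saW /cube_embeds_qdim hY.
pose G (s : seq R) := (M `&` W) (\row_(i < n) s`_i) /\
  f (\row_(i < n) s`_i) = s`_n.
have dG : definable_on n.+1 G.
  have h : definable (fun rho => W (\row_(i < n) rho i) /\
      (M (\row_(i < n) rho i) /\ f (\row_(i < n) rho i) = rho n)).
    apply: definable_and; first exact: semialgebraic_definable.
    by apply: (@definable_value (fun i rho => rho i) (fun rho => rho n)) => [?|];
      exact: polyfun_var.
  apply: (definable_iff h) => rho; rewrite /G nth_mkseq//.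
  have -> : \row_(i < n) (mkseq rho n.+1)`_i = \row_(i < n) rho i.
    by apply/rowP => i; rewrite !mxE nth_mkseq// (ltn_trans (ltn_ord i)).
  by split=> [[? [? ?]]|[[? ?] ?]].
have rowE s v : size s = n -> \row_(i < n) (rcons s v)`_i = \row_(i < n) s`_i.
  by move=> hs; apply/rowP => i; rewrite !mxE nth_rcons hs ltn_ord.
have nthE s v : size s = n -> (rcons s v)`_n = v.
  by move=> hs; rewrite nth_rcons hs ltnn eqxx.
have hfr : qdim n.+1 k.+1 (fun s => seq_closure n.+1 G s /\ ~ G s).
  (* Over each such q all v in ]a, b[ give frontier points, because q is not in M; this is one more
     infinite quantifier. *)
  apply: qdim_rcons hY => s hs [[[clq _] nMq [a [b [ab frb fra]]]] Wq].
  apply: infinite_sub (infinite_itv ab) => v /andP[av vb]; split; last first.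
    by rewrite /G rowE// => -[[]].
  move=> d d0; set q := \row_i s`_i in clq nMq frb fra Wq.
  have nU : nbhs q (W `&` box q d).
    apply: filterI; first exact: open_nbhs_nbhs.
    by apply/nbhs_box; exists d.
  (* The connected neighborhood lies in W and near q, and f takes values below a and above b on it,
     hence the value v. *)
  have [W' [[oW' saW' W'q] W'U conW']] := hconn ((closureE q).2 clq) nU.
  have [e e0 eW'] := (nbhs_box q W').1 (open_nbhs_nbhs (conj oW' W'q)).
  have [x [qx Mx /= fx]] := (frequentlyP _ _).1 fra e e0.
  have [y [qy My /= fy]] := (frequentlyP _ _).1 frb e e0.
  have [z [Mz W'z] fz] := connected_value saW' conW' (conj Mx (eW' _ qx))
    (conj My (eW' _ qy)) (lt_trans fx av) (lt_trans vb fy).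
  have [Wz qz] := W'U _ W'z.
  exists (rcons (seq_of_row z) v); split.
  - by rewrite size_rcons size_seq_of_row.
  - by rewrite /G rowE ?nthE ?size_seq_of_row// seq_of_rowK.
  - move=> i; rewrite ltnS leq_eqVlt => /orP[/eqP ->|hi].
      by rewrite !nthE ?size_seq_of_row// subrr normr0.
    rewrite !nth_rcons size_seq_of_row hs hi.
    by have := qz (Ordinal hi); rewrite mxE -(nth_seq_of_row z).
(* The frontier inequality gives k + 2 for the graph, and the last coordinate is a function of the
   others. *)
have := qdim_frontier dG hfr; rewrite -addn1 => /qdim_functional.
have func (s u v : seq R) : size s = n -> size u = 1%N -> size v = 1%N ->
    G (s ++ u) -> G (s ++ v) -> u = v.
  move=> hs; case: u => [|u []]//; case: v => [|v []]// _ _.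
  by rewrite !cats1 /G !rowE// !nthE// => -[_ <-] [_ <-].
move=> /(_ func) h; apply: qdim_cube_embeds; first exact: semialgebraic_setI.
apply: qdim_sub h => s hs [[|u []]// _].
by rewrite cats1 => -[]; rewrite rowE.
Qed.

(** With W realizing the local dimension of M at q, the dimension of Y inside W is at most that
    minus 2, and it bounds the local dimension of Y from above. *)
Lemma local_dim_oscillation_locus q : oscillation_locus q ->
  exists dY dM : int, [/\ is_local_dim oscillation_locus q dY,
    is_local_dim M q dM & dY <= dM - 2].
Proof.
move=> Yq; have clM : closure M q by apply/closureE; case: Yq => -[].
have saY := semialgebraic_oscillation_locus.
have [dM hM] := is_local_dim_ex saM clM.
have [dY hY] := is_local_dim_ex saY (subset_closure Yq).
exists dY%:Z, dM%:Z; split=> //.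
have [[W hW [_ maxW]] _] := hM; have [oW saW Wq] := hW.
have [|k hk] := is_dim_ex (semialgebraic_setI saY saW); first by exists q.
have h1 : dY%:Z <= k%:Z by apply: hY.2 hW hk.
case: hk => [[[Y0 _]|[j [<-] hj]] _]; first by have : set0 q by rewrite -Y0.
by have := maxW _ (cube_embeds_oscillation_locus oW saW hj); lia.
Qed.

End Extension.

Theorem theorem5 (R : rcfType) (n : nat) (M : set 'rV[R]_n)
    (hM : semialgebraic M)
    (hconn : forall q, closure M q -> germ_connected M q)
    (f : 'rV[R]_n -> R) (hf : semialgebraic_function M f) :
  exists V Y : set 'rV[R]_n,
    [/\ semialgebraic V, open_in (closure M) V & M `<=` V] /\
    [/\ semialgebraic Y, Y `<=` closure M `\` M &
        forall q, Y q ->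
          exists dY dM : int,
            [/\ is_local_dim Y q dY, is_local_dim M q dM & dY <= dM - 2]] /\
    exists F : 'rV[R]_n -> R,
      {within V `\` Y, continuous F} /\ {in M, F =1 f}.
Proof.
exists (bounded_locus M f), (oscillation_locus M f); split; [split|split; [split|]].
- exact: semialgebraic_bounded_locus.
- exists [set q | bounded_near M f q]; first exact: open_bounded_near.
  by apply/seteqP; split=> q [h1 h2]; split=> //; apply/(closureE M f).
- exact: sub_bounded_locus.
- exact: semialgebraic_oscillation_locus.
- by move=> q [[clq _] nMq _]; split=> //; apply/(closureE M f).
- exact: local_dim_oscillation_locus.
- exact: continuous_extension.
Qed.
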